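(* (Decay at infinity principle for systems.) Let $n\ge2$, $\alpha\in(0,2)$ and $f,g,h,l\in C^1([0,+\infty)\times[0,+\infty),\mathbb{R})$. Let $(u,v)\in\left(L_\alpha\cap C^{1,\theta}_{loc}(\mathbb{R}^n)\right)^2$, for some $\theta>\max\{0,\alpha-1\}$, be a positive solution of the system $$\begin{cases}(-\Delta)^{\frac{\alpha}{2}}u(x)=f(u(x),v(x)), & x\in\mathbb{R}^n_+,\\ (-\Delta)^{\frac{\alpha}{2}}v(x)=g(u(x),v(x)), & x\in\mathbb{R}^n_+,\\ \mathcal{N}_{\frac{\alpha}{2}}u(x)=h(u(x),v(x)), & x\in\mathbb{R}^n\setminus\overline{\mathbb{R}^n_+},\\ \mathcal{N}_{\frac{\alpha}{2}}v(x)=l(u(x),v(x)), & x\in\mathbb{R}^n\setminus\overline{\mathbb{R}^n_+}.\end{cases}$$ Suppose that, for some constants $a,b>0$ and $p,q,r,s\ge1$: (i) $u(x)\le\frac{1}{|x|^a}$ and $v(x)\le\frac{1}{|x|^b}$ as $|x|\to\infty$ (i.e. for all sufficiently large $|x|$); (ii) $\frac{\partial f}{\partial u}\le u^{p-1}v^q$ and $\frac{\partial g}{\partial v}\le u^rv^{s-1}$ as $(u,v)\to(0^+,0^+)$ (i.e. for all sufficiently small $u,v>0$); (iii) $\frac{\partial f}{\partial v}\le u^pv^{q-1}$ and $\frac{\partial g}{\partial u}\le u^{r-1}v^s$ as $(u,v)\to(0^+,0^+)$ (same meaning); (iv) $\frac{\partial f}{\partial v}>0$ and $\frac{\partial g}{\partial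 u}>0$ for all $(u,v)\in\mathbb{R}^+\times\mathbb{R}^+$; (v) $\frac{\partial h}{\partial u}<0$, $\frac{\partial l}{\partial v}<0$, $\frac{\partial h}{\partial v}>0$, $\frac{\partial l}{\partial u}>0$ for all $(u,v)\in\mathbb{R}^+\times\mathbb{R}^+$; (vi) $\mu,\nu>0$ are constants with $\mu\nu>1$ such that $-\frac{\partial h}{\partial u}\ge\mu\frac{\partial h}{\partial v}$ and $-\frac{\partial l}{\partial v}\ge\nu\frac{\partial l}{\partial u}$ for all $(u,v)\in\mathbb{R}^+\times\mathbb{R}^+$; (vii) $\alpha<\min\{ap+bq-a,\ ap+bq-b,\ ar+bs-a,\ ar+bs-b\}$. Then there exists a constant $R_0>0$ such that for all $\lambda<0$: (a) if there is $x^*\in H_\lambda$ with $|x^*|>R_0$ and $U_\lambda(x^* )=\min_{x\in\overline{H_\lambda}}U_\lambda(x)<0$, then $V_\lambda(x^* )<\mu U_\lambda(x^* )<0$; (b) if there is $y^*\in H_\lambda$ with $|y^*|>R_0$ and $V_\lambda(y^* )=\min_{y\in\overline{H_\lambda}}V_\lambda(y)<0$, then $U_\lambda(y^* )<\nu V_\lambda(y^* )<0$.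
   Context: $\mathbb{R}^n_+=\{x=(x_1,\dots,x_n)\in\mathbb{R}^n : x_n>0\}$ and $\mathbb{R}^+=(0,\infty)$. For $\lambda\in\mathbb{R}$, $H_\lambda=\{x\in\mathbb{R}^n : x_1<\lambda\}$ and $x^\lambda=(2\lambda-x_1,x_2,\dots,x_n)$ is the reflection of $x$ in the hyperplane $\{x_1=\lambda\}$ (here $x_1$ is a direction tangential to $\partial\mathbb{R}^n_+$, so $x_1\ne x_n$). Put $U_\lambda(x)=u(x^\lambda)-u(x)$ and $V_\lambda(x)=v(x^\lambda)-v(x)$. The fractional Laplacian is $$(-\Delta)^{\frac{\alpha}{2}}u(x)=C_{n,\alpha}\lim_{\epsilon\to0}\int_{\mathbb{R}^n\setminus B_\epsilon(x)}\frac{u(x)-u(y)}{|x-y|^{n+\alpha}}\,dy,$$ where $C_{n,\alpha}>0$ is the usual normalization constant. The nonlocal normal derivative is $$\mathcal{N}_{\frac{\alpha}{2}}u(x)=C_{n,\alpha}\int_{\mathbb{R}^n_+}\frac{u(x)-u(y)}{|x-y|^{n+\alpha}}\,dy,\qquad x\in\mathbb{R}^n\setminus\overline{\mathbb{R}^n_+}\ (\text{i.e. }x_n<0).$$ $L_\alpha=\left\{u:\mathbb{R}^n\to\mathbb{R} : \int_{\mathbb{R}^n}\frac{|u(x)|}{1+|x|^{n+\alpha}}dx<\infty\right\}$. A positive solution means $u>0$ and $v>0$ on $\mathbb{R}^n$; equations are understood pointwise. Partial derivatives of $f,g,h,l$ with respect to $u$ and $v$ denote derivatives in the first and second argument. 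*)

(* Defs.v *)
From HB Require Import structures.
From mathcomp Require Import all_boot all_order all_algebra.
From mathcomp Require Import all_classical all_reals all_analysis.

Set Implicit Arguments.
Unset Strict Implicit.
Unset Printing Implicit Defensive.

Import Order.TTheory GRing.Theory Num.Theory.
Import numFieldNormedType.Exports.

Local Open Scope classical_set_scope.
Local Open Scope ring_scope.

(* Lebesgue measure on R^n lives on the Borel sets of n.-tuple R: the measure
   on R^n.+1 is the image of the product measure under (t, x) |-> t :: x. *)
Section lebesgue_cons.
Context {R : realType} (n : nat).
Local Notation TR := (measurableTypeR R).
Variable mu : {sigma_finite_measure set (n.-tuple TR) -> \bar R}.

Definition tuple_cons (p : TR * n.-tuple TR) : n.+1.-tuple TR :=
  [tuple of p.1 :: p.2].

Definition tuple_uncons (t : n.+1.-tuple TR) : TR * n.-tuple TR :=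
  (thead t, [tuple of behead t]).

Lemma tuple_consK : cancel tuple_cons tuple_uncons.
Proof. by case=> a t; congr pair => //; apply/val_inj. Qed.

Lemma tuple_unconsK : cancel tuple_uncons tuple_cons.
Proof. by move=> t; rewrite /tuple_cons/= -tuple_eta. Qed.

Lemma measurable_tuple_cons : measurable_fun setT tuple_cons.
Proof. exact: measurable_cons. Qed.

Lemma measurable_tuple_uncons : measurable_fun setT tuple_uncons.
Proof.
apply: measurable_fun_pair; last exact: measurable_behead.
exact: measurable_tnth.
Qed.

Definition lebesgue_cons : set (n.+1.-tuple TR) -> \bar R :=
  pushforward (lebesgue_measure \x mu)%E tuple_cons.

Let lebesgue_cons0 : lebesgue_cons set0 = 0%E.
Proof. by rewrite /lebesgue_cons/pushforward preimage_set0 measure0. Qed.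

Let lebesgue_cons_ge0 A : (0 <= lebesgue_cons A)%E.
Proof. by rewrite /lebesgue_cons/pushforward measure_ge0. Qed.

Let lebesgue_cons_sigma_additive : semi_sigma_additive lebesgue_cons.
Proof.
move=> F mF tF mUF; rewrite /lebesgue_cons/pushforward preimage_bigcup.
apply: measure_semi_sigma_additive.
- by move=> k; rewrite -[X in measurable X]setTI; exact: measurable_tuple_cons.
- apply/trivIsetP => /= i j _ _ ij; rewrite -preimage_setI.
  by move/trivIsetP : tF => /(_ _ _ _ _ ij) ->//; rewrite preimage_set0.
- rewrite -preimage_bigcup -[X in measurable X]setTI.
  exact: measurable_tuple_cons.
Qed.

HB.instance Definition _ := isMeasure.Build _ _ _ lebesgue_cons
  lebesgue_cons0 lebesgue_cons_ge0 lebesgue_cons_sigma_additive.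

Let lebesgue_cons_sigma_finite : sigma_finite setT lebesgue_cons.
Proof.
have /sigma_finiteP[F [TF ndF Foo]] := sigma_finiteT (@lebesgue_measure R).
have /sigma_finiteP[G [TG ndG Goo]] := sigma_finiteT mu.
exists (fun k => tuple_uncons @^-1` (F k `*` G k)).
  apply/esym; rewrite -subTset => t _.
  have [i _ Fi] : (\bigcup_i F i) (thead t) by rewrite -TF.
  have [j _ Gj] : (\bigcup_i G i) [tuple of behead t] by rewrite -TG.
  exists (maxn i j) => //; split.
  - by move: Fi; exact/subsetPset/ndF/leq_maxl.
  - by move: Gj; exact/subsetPset/ndG/leq_maxr.
move=> k; have [mF Fk] := Foo k; have [mG Gk] := Goo k; split.
  rewrite -[X in measurable X]setTI; apply: measurable_tuple_uncons => //.
  exact: measurableX.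
rewrite /lebesgue_cons/pushforward -comp_preimage.
rewrite (_ : _ \o _ = id); last by apply/funext => p/=; rewrite tuple_consK.
by rewrite preimage_id product_measure1E// lte_mul_pinfty// ge0_fin_numE.
Qed.

HB.instance Definition _ := Measure_isSigmaFinite.Build _ _ _ lebesgue_cons
  lebesgue_cons_sigma_finite.

End lebesgue_cons.

Fixpoint lebesgue_tuple {R : realType} (n : nat) :
    {sigma_finite_measure set (n.-tuple (measurableTypeR R)) -> \bar R} :=
  match n return
    {sigma_finite_measure set (n.-tuple (measurableTypeR R)) -> \bar R} with
  | 0 => \d_ [tuple]
  | m.+1 => lebesgue_cons (lebesgue_tuple m)
  end.


Lemma lebesgue_tuple_box {R : realType} (n : nat)
    (A : 'I_n -> set (measurableTypeR R)) : (forall i, measurable (A i)) ->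
  lebesgue_tuple n [set t | forall i, A i (tnth t i)] =
  (\prod_(i < n) lebesgue_measure (A i))%E.
Proof.
elim: n A => [|n IHn] A mA /=.
  by rewrite big_ord0 diracE mem_set//= => -[].
rewrite big_ord_recl -IHn// -product_measure1E//; last first.
  rewrite (_ : [set t | _] = \bigcap_(i in [set: 'I_n])
    ((fun t => tnth t i) @^-1` A (lift ord0 i))); last first.
    by apply/seteqP; split => t /= At i; [move=> _|]; exact: At.
  apply: fin_bigcap_measurable => // i _; rewrite -[X in measurable X]setTI.
  exact: measurable_tnth.
rewrite /lebesgue_cons/pushforward; congr product_measure1.
apply/seteqP; split => -[a t] /=.
  move=> At; split=> [|i]; first exact: (At ord0).
  by have := At (lift ord0 i); rewrite tnthS.
move=> [Aa At] i; case: (unliftP ord0 i) => [j|] ->; last exact: Aa.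
by rewrite tnthS.
Qed.

Section euclidean_space.
Context {R : realType}.
Implicit Types (n : nat) (alpha theta : R).

(* The library norm of 'rV[R]_n is the sup norm. *)
Definition enorm n (x : 'rV[R]_n) : R := Num.sqrt (\sum_(i < n) x 0 i ^+ 2).

Definition row_of n (t : n.-tuple R) : 'rV[R]_n := \row_i tnth t i.

Definition integral_Rn n (D : set 'rV[R]_n) (f : 'rV[R]_n -> R) : \bar R :=
  (\int[lebesgue_tuple n]_(t in @row_of n @^-1` D) (f (row_of t))%:E)%E.

Definition Gamma (s : R) : R :=
  fine (\int[lebesgue_measure]_(t in `]0%R, +oo[)
    (t `^ (s - 1) * expR (- t))%:E)%E.

(* C_{n,alpha} = 2^alpha Gamma((n + alpha)/2) / (pi^(n/2) |Gamma(-alpha/2)|),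
   rewritten with |Gamma(-alpha/2)| = (2/alpha) Gamma(1 - alpha/2) so that
   Gamma is only used at positive arguments. *)
Definition frac_const n alpha : R :=
  alpha * 2 `^ (alpha - 1) * Gamma ((n%:R + alpha) / 2) /
  (pi `^ (n%:R / 2) * Gamma (1 - alpha / 2)).

Definition frac_quotient n alpha (u : 'rV[R]_n -> R) (x y : 'rV[R]_n) : R :=
  (u x - u y) / enorm (x - y) `^ (n%:R + alpha).

(* (-Delta)^(alpha/2) u (x) exists and is equal to l *)
Definition is_frac_laplacian n alpha (u : 'rV[R]_n -> R) (x : 'rV[R]_n)
    (l : R) : Prop :=
  ((frac_const n alpha)%:E *
     integral_Rn [set y | (eps <= enorm (x - y))%R] (frac_quotient alpha u x))%E
  @[eps --> 0^'+] --> l%:E.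

(* R^n.+1 with the coordinates x_1 = x 0 ord0 and x_n = x 0 ord_max *)
Definition upper_half_space n : set 'rV[R]_n.+1 := [set x | 0 < x 0 ord_max].

Definition nonlocal_normal n alpha (u : 'rV[R]_n.+1 -> R) (x : 'rV[R]_n.+1) :
    \bar R :=
  ((frac_const n.+1 alpha)%:E *
     integral_Rn (@upper_half_space n) (frac_quotient alpha u x))%E.

Definition left_half_space n (lambda : R) : set 'rV[R]_n.+1 :=
  [set x | x 0 ord0 < lambda].

Definition reflection n (lambda : R) (x : 'rV[R]_n.+1) : 'rV[R]_n.+1 :=
  \row_i if i == ord0 then 2 * lambda - x 0 i else x 0 i.

Definition reflection_diff n (lambda : R) (u : 'rV[R]_n.+1 -> R)
    (x : 'rV[R]_n.+1) : R := u (reflection lambda x) - u x.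

Definition L_space n alpha : set ('rV[R]_n -> R) :=
  [set u | (lebesgue_tuple n).-integrable setT (fun t : n.-tuple R =>
    (`|u (row_of t)| / (1 + enorm (row_of t) `^ (n%:R + alpha)))%:E)].

Definition partial n (i : 'I_n) (u : 'rV[R]_n -> R) (x : 'rV[R]_n) : R :=
  'D_(delta_mx 0 i) u x.

(* C^{1,theta}_loc(R^n), theta > 0; continuity of the partial derivatives
   follows from their local Hoelder continuity. *)
Definition C1_holder_loc n theta : set ('rV[R]_n -> R) :=
  [set u | (forall x, differentiable u x) /\
    forall (i : 'I_n) (K : set 'rV[R]_n), compact K ->
      exists M : R, forall x y, K x -> K y ->
        `|partial i u x - partial i u y| <= M * enorm (x - y) `^ theta].

End euclidean_space.

Section quadrant.
Context {R : realType}.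
Implicit Types (f : R * R -> R) (z : R * R).

Definition closed_quadrant : set (R * R) := [set z | 0 <= z.1 /\ 0 <= z.2].
Definition open_quadrant : set (R * R) := [set z | 0 < z.1 /\ 0 < z.2].

Definition partial1 f z : R := 'D_((1, 0) : R * R) f z.
Definition partial2 f z : R := 'D_((0, 1) : R * R) f z.

(* C^1([0,+oo) x [0,+oo)): continuous up to the boundary, C^1 inside, with
   first partial derivatives that extend continuously to the closed quadrant.
   Values of f outside the closed quadrant are irrelevant. *)
Definition C1_quadrant : set (R * R -> R) :=
  [set f | {within closed_quadrant, continuous f} /\
    (forall z, open_quadrant z -> differentiable f z) /\
    exists f1 f2 : R * R -> R,
      [/\ {within closed_quadrant, continuous f1},
          {within closed_quadrant, continuous f2} &
          forall z, open_quadrant z ->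
            f1 z = partial1 f z /\ f2 z = partial2 f z]].

End quadrant.

(* Main.v *)
(** At a negative minimum [x] of [U y = u (y^lambda) - u y] over the left half
    space, symmetrise the singular integral over a reflection-invariant domain:
    [U] is odd under the reflection and the kernel [K] is larger between points
    on the same side, so [F y = (U x - U y) K (x - y)] satisfies
    [F y + F (y^lambda) <= 2 U x K (x - y)] for [y] beyond the hyperplane. As
    [lambda < 0], a cube of side [2 |x|] lies beyond it, and the difference of
    the operators at [x^lambda] and [x] is at most [- c |x|^(-alpha) |U x|].

    If [x_n > 0], this bounds [f (u, v) (x^lambda) - f (u, v) (x)] from above,
    while [V x >= mu U x], the mean value theorem and the decay of [u] and [v]
    bound it from below by [- (1 + mu) |x|^(- e) |U x|] with [e > alpha]; this
    is impossible for [|x|] large. If [x_n <= 0], use the equation at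
    [x - t e_n] and let [t] tend to 0: the gradient of [U] vanishes at [x],
    hence [U (x - t e_n) - U x = O(t^(1 + theta))], whereas the kernel has mass
    [O(t^(- alpha))] over the half space and [1 + theta > alpha]. In the limit
    [h (u, v) (x^lambda) < h (u, v) (x)], but [h] does not decrease along that
    segment when [V x >= mu U x]. The second claim is the first one with the
    roles of [u] and [v] exchanged. *)
From HB Require Import structures.
Require Import Defs.
From mathcomp Require Import all_boot all_order all_algebra.
From mathcomp Require Import all_classical all_reals all_analysis.
From mathcomp Require Import measurable_realfun ring lra.
Set Implicit Arguments.
Unset Strict Implicit.
Unset Printing Implicit Defensive.
Import Order.TTheory GRing.Theory Num.Theory.
Import numFieldNormedType.Exports.
Local Open Scope classical_set_scope.
Local Open Scope ring_scope.
(** * Reflection invariance of Lebesgue measure *)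

Section reflection_invariance.
Context {R : realType}.
Local Notation TR := (measurableTypeR R).
Implicit Types (n : nat) (lambda : R).

Definition subl (c : R) (t : TR) : TR := c - t.

Lemma measurable_subl (c : R) : measurable_fun [set: TR] (subl c).
Proof. exact: measurable_funB. Qed.

HB.instance Definition _ c :=
  isMeasurableFun.Build _ _ _ _ (subl c) (measurable_subl c).

(** Lebesgue measure is determined by its values on half-open intervals, so only these are
    checked. *)
Lemma lebesgue_measure_subl (c : R) (A : set TR) : measurable A ->
  lebesgue_measure (subl c @^-1` A) = lebesgue_measure A.
Proof.
move=> mA; apply/esym.
rewrite (lebesgue_measure_unique (mu := pushforward lebesgue_measure (subl c))) //.
move=> X [[a b] ab <-]/=; rewrite /pushforward.
(* The open and closed ends trade places, which leaves the length unchanged. *)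
rewrite (_ : _ @^-1` _ = `[c - b, c - a[%classic); last first.
  by apply/seteqP; split=> t/=; rewrite /subl !in_itv/= => /andP[? ?];
    apply/andP; split; lra.
rewrite !lebesgue_measure_itv/= !lte_fin; case: ltP => ab1; case: ltP => ab2 //.
- by rewrite -!EFinB; congr (_%:E); lra.
- by exfalso; lra.
- by exfalso; lra.
Qed.
End reflection_invariance.

Section reflection_tuple.
Context {R : realType}.
Local Notation TR := (measurableTypeR R).
Implicit Types (n : nat) (lambda : R).

Definition reflect_tuple n lambda (t : n.+1.-tuple TR) : n.+1.-tuple TR :=
  tuple_cons (subl (2 * lambda) (thead t), [tuple of behead t]).

Lemma row_of_reflect n lambda (t : n.+1.-tuple TR) :
  row_of (reflect_tuple lambda t) = reflection lambda (row_of t).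
Proof.
apply/rowP => i; rewrite !mxE; case: (unliftP ord0 i) => [j|] -> /=.
  rewrite tnthS tnth_behead; congr (tnth t _); apply/val_inj.
  by rewrite /= inordK// ltnS; exact: ltn_ord.
by rewrite tnth0.
Qed.

Lemma reflect_tupleK n lambda : involutive (@reflect_tuple n lambda).
Proof.
move=> t; rewrite [RHS]tuple_eta; apply/val_inj => /=; congr cons.
by rewrite /reflect_tuple /subl /thead /= tnth0; exact: subKr.
Qed.

Lemma measurable_reflect_tuple n lambda :
  measurable_fun [set: n.+1.-tuple TR] (@reflect_tuple n lambda).
Proof.
apply: (measurableT_comp (@measurable_tuple_cons R n)).
apply: measurable_fun_pair; last exact: measurable_behead.
apply: (measurableT_comp (measurable_subl _)); exact: measurable_tnth.
Qed.

Let reflect_fst n lambda (p : TR * n.-tuple TR) : TR * n.-tuple TR :=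
  (subl (2 * lambda) p.1, p.2).

Let measurable_reflect_fst n lambda : measurable_fun setT (@reflect_fst n lambda).
Proof.
apply: measurable_fun_pair => //; exact: (measurableT_comp (measurable_subl _)).
Qed.

HB.instance Definition _ n lambda :=
  isMeasurableFun.Build _ _ _ _ (@reflect_fst n lambda)
    (@measurable_reflect_fst n lambda).

(** Through [tuple_cons] the reflection acts on the first factor of a product measure only. Such a
    measure is determined by rectangles, where invariance is one-dimensional. *)
Lemma lebesgue_tuple_reflect n lambda (A : set (n.+1.-tuple TR)) :
  measurable A ->
  pushforward (lebesgue_tuple n.+1) (reflect_tuple lambda) A = lebesgue_tuple n.+1 A.
Proof.
move=> mA; rewrite /= /lebesgue_cons /pushforward.
have reflect_cons : @tuple_cons R n @^-1` (reflect_tuple lambda @^-1` A) =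
    @reflect_fst n lambda @^-1` (@tuple_cons R n @^-1` A).
  suff E (p : TR * n.-tuple TR) :
      reflect_tuple lambda (tuple_cons p) = tuple_cons (reflect_fst lambda p).
    by apply/seteqP; split => p /=; rewrite E.
  case: p => a t; rewrite /= /reflect_tuple /reflect_fst /=.
  by rewrite /tuple_cons /= theadE; apply/val_inj.
rewrite [RHS](product_measure_unique
  (m' := pushforward (lebesgue_measure \x lebesgue_tuple n)%E (@reflect_fst n lambda))).
- by rewrite /pushforward reflect_cons.
- move=> X Y mX mY; transitivity ((lebesgue_measure \x lebesgue_tuple n)%E
    ((subl (2 * lambda) @^-1` X) `*` Y)); first by [].
  rewrite product_measure1E//.
    by congr (_ * _)%E; exact: lebesgue_measure_subl.
  by rewrite -[X in measurable X]setTI; exact: measurable_subl.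
- by rewrite -[X in measurable X]setTI; exact: measurable_tuple_cons.
Qed.
End reflection_tuple.

(** * Dyadic estimates and positivity of the normalization constant *)

Section dyadic.
Local Open Scope ereal_scope.
Context d (T : measurableType d) (R : realType) (mu : {measure set T -> \bar R}).

(** The cover is made disjoint inside [D]; the [k]-th piece then contributes at most
    [c k * mu (E k)], and these bounds sum to a geometric series. With dyadic pieces this serves for
    the Gamma integral at both ends and for the singular kernel. *)
Lemma ge0_integral_le_geometric (D : set T) (E : nat -> set T) (f : T -> R)
    (c : nat -> R) (C rho : R) :
  measurable D -> (forall k, measurable (E k)) -> D `<=` \bigcup_k E k ->
  measurable_fun D f -> (forall t, D t -> (0 <= f t)%R) ->
  (forall k t, D t -> E k t -> (f t <= c k)%R) ->
  (forall k, (0 <= c k)%R) ->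
  (forall k, (c k)%:E * mu (E k) <= (C * rho ^+ k)%:E) ->
  (0 < rho < 1)%R ->
  \int[mu]_(t in D) (f t)%:E <= (C / (1 - rho))%:E.
Proof.
move=> mD mE DE mf f0 fc c0 cE /andP[rho0 rho1].
pose F k := D `&` E k.
have DF : D = \bigcup_k seqDU F k.
  rewrite -seqDU_bigcup_eq; apply/seteqP; split => [t Dt|t [k _ []]//].
  by have [k _ Ekt] := DE _ Dt; exists k.
have mF k : measurable (F k) by exact: measurableI.
have mU k : measurable (seqDU F k).
  by rewrite /seqDU; apply: measurableD => //; apply: bigsetU_measurable.
have sF k t : seqDU F k t -> F k t by case.
have sD k : seqDU F k `<=` D by move=> t /sF[].
have C0 : (0 <= C)%R.
  have := cE 0%N; rewrite expr0 mulr1 -lee_fin; apply: le_trans.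
  by rewrite mule_ge0// lee_fin.
have mfU : measurable_fun (\bigcup_k seqDU F k) (fun t => (f t)%:E).
  by rewrite -DF; exact/measurable_EFinP.
rewrite {1}DF ge0_integral_bigcup//; last first.
  by move=> t [k _ /sD Dt]; rewrite lee_fin f0.
have key k : \int[mu]_(t in seqDU F k) (f t)%:E <= (C * rho ^+ k)%:E.
  apply: (@le_trans _ _ (\int[mu]_(t in seqDU F k) (cst (c k)%:E t))).
    apply: ge0_le_integral => //.
    - by move=> t /sD Dt; rewrite lee_fin f0.
    - by apply/measurable_EFinP; apply: measurable_funS mf => //; exact: sD.
    - by move=> t /sF[Dt Et]; rewrite lee_fin (fc k).
  rewrite integral_cst//; apply: le_trans (cE k).
  rewrite lee_wpmul2l ?lee_fin// le_measure ?inE//.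
  by move=> t /sF[].
have pos k : 0 <= \int[mu]_(t in seqDU F k) (f t)%:E.
  by apply: integral_ge0 => t /sD Dt; rewrite lee_fin f0.
apply: lime_le; first exact: is_cvg_nneseries.
apply: nearW => m.
apply: (@le_trans _ _ (\sum_(0 <= k < m) (C * rho ^+ k)%:E)).
  by apply: lee_sum => k _; exact: key.
rewrite sumEFin lee_fin; apply: geometric_le_lim => //.
by rewrite ger0_norm ?ltW.
Qed.
End dyadic.

(** * Finiteness and positivity of the Gamma integral *)

Section gamma.
Context {R : realType}.
Implicit Types (r delta s t : R).

(** Take the least [k] for which the upper bound holds; minimality gives the lower one. *)
Lemma dyadic_floor r delta : 0 < delta <= r ->
  exists k, 2 ^+ k * delta <= r < 2 ^+ k.+1 * delta.
Proof.
move=> /andP[d0 dr].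
have ex : exists k, r < 2 ^+ k.+1 * delta.
  exists (Num.trunc (r / delta)); rewrite -ltr_pdivrMr//.
  have /andP[_ /lt_le_trans] := trunc_itv (divr_ge0 (le_trans (ltW d0) dr) (ltW d0)).
  by apply; rewrite -natrX ler_nat ltnW// ltn_expl.
case: (ex_minnP ex) => k rk kmin; exists k; rewrite rk andbT.
case: k {rk} kmin => [|k] kmin; first by rewrite expr0 mul1r.
by rewrite leNgt; apply/negP => /kmin; rewrite ltnn.
Qed.

Let gamma_integrand s t : R := t `^ (s - 1) * expR (- t).

Let measurable_gamma s (D : set R) : measurable_fun D (gamma_integrand s).
Proof.
apply: measurable_funTS; apply: measurable_funM; first exact: measurable_powR.
by apply: measurableT_comp => //; exact: measurable_funN.
Qed.

Let gamma_ge0 s t : 0 <= gamma_integrand s t.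
Proof. by rewrite mulr_ge0 ?powR_ge0 ?expR_ge0. Qed.

Let powRB1 s t : 0 < t -> t `^ (s - 1) = t `^ s / t.
Proof.
by move=> t0; rewrite powRB ?(gt_eqF t0) ?implybT// powRr1 ?(ltW t0).
Qed.

Lemma gamma_integral_le1_lty s : 0 < s ->
  (\int[lebesgue_measure]_(t in `]0%R, 1%R]) (gamma_integrand s t)%:E < +oo)%E.
Proof.
move=> s0.
pose E k := [set` `[(2 ^- k.+1 : R), 2 ^- k]].
(* Writing [t]^ (s - 1)[as]t [^ s / t] makes each factor monotone, whatever the sign of [s - 1]. *)
pose c k : R := (2 ^- k) `^ s / 2 ^- k.+1.
apply: (@le_lt_trans _ _ (1 / (1 - 2 `^ (- s)))%:E); last by rewrite ltry.
apply: (@ge0_integral_le_geometric _ _ R lebesgue_measure _ E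
  (gamma_integrand s) c 1 (2 `^ (- s))) => //.
- by move=> k; exact: measurable_itv.
- move=> t /=; rewrite in_itv/= => /andP[t0 t1].
  have [|k /andP[]] := @dyadic_floor t^-1 1; first by rewrite ltr01 invf_ge1.
  rewrite !mulr1 => k1 k2; exists k => //; rewrite /E/= in_itv/=; apply/andP; split.
    by rewrite -[leRHS]invrK lef_pV2 ?posrE ?invr_gt0 ?exprn_gt0// ltW.
  by rewrite -[leLHS]invrK lef_pV2 ?posrE ?invr_gt0 ?exprn_gt0.
- exact: measurable_gamma.
- move=> k t; rewrite /E/= !in_itv/= => /andP[t0 _] /andP[t1 t2].
  rewrite /gamma_integrand powRB1// /c.
  apply: (@le_trans _ _ (t `^ s / t)).
    by rewrite ler_piMr ?divr_ge0 ?powR_ge0 ?ltW// expR_lt1 oppr_lt0.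
  rewrite ler_pM ?invr_ge0 ?powR_ge0 ?(ltW t0)//.
    by rewrite ge0_ler_powR ?nnegrE ?(ltW t0) ?(ltW s0) ?invr_ge0 ?exprn_ge0.
  by rewrite lef_pV2 ?posrE ?invr_gt0 ?exprn_gt0.
- by move=> k; rewrite /c divr_ge0 ?powR_ge0// invr_ge0 exprn_ge0.
- move=> k; rewrite /E /= lebesgue_measure_itv/= lte_fin ifT; last first.
    by rewrite ltf_pV2 ?posrE ?exprn_gt0// exprS ltr_pMl ?exprn_gt0// ltr1n.
  rewrite -EFinB -EFinM lee_fin /c mul1r.
  have -> : (2 ^- k : R) - 2 ^- k.+1 = 2 ^- k.+1.
    by rewrite exprS invfM; field; rewrite expf_eq0 pnatr_eq0 andbF.
  rewrite divfK ?invr_eq0 ?expf_eq0 ?pnatr_eq0 ?andbF//.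
  by rewrite -powR_invn// -powRrM mulNr mulrC -mulNr powRrM powR_mulrn ?powR_ge0.
- rewrite powR_gt0//= powRN invf_lt1 ?powR_gt0//.
  by have := @gt0_ltr_powR R s s0 1 2; rewrite powR1 !nnegrE; apply; rewrite ?ltr1n.
Qed.

Lemma gamma_integral_ge1_lty s :
  (\int[lebesgue_measure]_(t in `[1%R, +oo[) (gamma_integrand s t)%:E < +oo)%E.
Proof.
(* With [s + 1 <= m.+1], the bound [t ^+ m.+1 <= M * expR t] gives an integrand of at most
   [M * t ^- 2] for [1 <= t]. *)
pose m := Num.trunc (`|s| + 1); pose M : R := m.+1`!%:R.
pose E k := [set` `[(2 ^+ k : R), 2 ^+ k.+1]].
pose c k : R := M * (2 ^- k) ^+ 2.
apply: (@le_lt_trans _ _ (M / (1 - 2^-1))%:E); last by rewrite ltry.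
apply: (@ge0_integral_le_geometric _ _ R lebesgue_measure _ E
  (gamma_integrand s) c M 2^-1) => //.
- by move=> k; exact: measurable_itv.
- move=> t /=; rewrite in_itv/= andbT => t1.
  have [|k /andP[]] := @dyadic_floor t 1; first by rewrite ltr01.
  rewrite !mulr1 => k1 k2; exists k => //; rewrite /E/= in_itv/=; apply/andP; split => //.
  exact: ltW.
- exact: measurable_gamma.
- move=> k t; rewrite /E/= !in_itv/= andbT => t1 /andP[kt _].
  have t0 : 0 < t by exact: lt_le_trans t1.
  apply: (@le_trans _ _ (M * t ^- 2)); last first.
    rewrite /c -(exprVn t) ler_pM2l ?ltr0n ?fact_gt0//.
    rewrite lerXn2r ?nnegrE ?invr_ge0 ?exprn_ge0 ?(ltW t0)//.
    by rewrite lef_pV2 ?posrE ?exprn_gt0.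
  rewrite /gamma_integrand expRN ler_pdivrMr ?expR_gt0// mulrAC ler_pdivlMr ?exprn_gt0//.
  apply: (@le_trans _ _ (t ^+ m.+1)).
    rewrite -!powR_mulrn ?(ltW t0)// -powRD; last by rewrite (gt_eqF t0) implybT.
    apply: ler_powR => //.
    have /andP[_] := trunc_itv (addr_ge0 (normr_ge0 s) ler01).
    rewrite -/m => sm; apply: le_trans (ltW sm).
    by have := ler_norm s; lra.
  have := expR_ge1Dxn m (ltW t0); rewrite -/M => h.
  have : t ^+ m.+1 / M <= expR t by apply: le_trans h; rewrite lerDr.
  by rewrite ler_pdivrMr ?ltr0n ?fact_gt0// mulrC.
- by move=> k; rewrite /c mulr_ge0// exprn_ge0// invr_ge0 exprn_ge0.
- move=> k; rewrite /E /= lebesgue_measure_itv/= lte_fin ifT; last first.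
    by rewrite exprS ltr_pMl ?exprn_gt0// ltr1n.
  rewrite -EFinB -EFinM lee_fin /c !exprVn.
  rewrite le_eqVlt; apply/orP; left; apply/eqP.
  by rewrite (exprS 2); field; rewrite expf_eq0 pnatr_eq0 andbF.
- by apply/andP; split; lra.
Qed.

(** Finiteness matters as much as positivity, because [fine] sends an infinite integral to 0. *)
Lemma Gamma_gt0 s : 0 < s -> 0 < Gamma s.
Proof.
move=> s0; pose I A := (\int[lebesgue_measure]_(t in A) (gamma_integrand s t)%:E)%E.
have mg A : measurable_fun A (fun t => (gamma_integrand s t)%:E).
  by apply/measurable_EFinP; exact: measurable_gamma.
have Ilty : (I `]0%R, +oo[%classic < +oo)%E.
  apply: (@le_lt_trans _ _ (I `]0%R, 1%R]%classic + I `[1%R, +oo[%classic)%E).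
    have -> : `]0%R, +oo[%classic = `]0%R, 1%R]%classic `|` `]1%R, +oo[%classic :> set R.
      apply/seteqP; split => t /=; rewrite !in_itv/= !andbT.
        by move=> t0; case: (leP t 1) => t1; [left; rewrite t0|right].
      by move=> [/andP[]//|]; exact: lt_trans.
    rewrite /I ge0_integral_setU//=; last 3 first.
    - exact: mg.
    - by move=> t _; rewrite lee_fin.
    - rewrite disj_set2E; apply/eqP/seteqP; split => // t /=; rewrite !in_itv/= !andbT.
      by move=> [/andP[_ t1] t2]; move: (le_lt_trans t1 t2); rewrite ltxx.
    rewrite leeD2l//.
    apply: ge0_subset_integral;
      [by []|by []|exact: mg|by move=> t _; rewrite lee_fin|].
    by move=> t /=; rewrite !in_itv/= !andbT; exact: ltW.
  by rewrite lte_add_pinfty ?gamma_integral_le1_lty ?gamma_integral_ge1_lty.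
have Ipos : ((expR (- 2) / 2)%:E <= I `]0%R, +oo[%classic)%E.
  apply: (@le_trans _ _ (I `[1%R, 2%R]%classic)).
    apply: (@le_trans _ _ (\int[lebesgue_measure]_(t in `[1%R, 2%R])
        (cst (expR (-2) / 2)%:E t))%E).
      rewrite integral_cst//= lebesgue_measure_itv/= lte_fin ifT ?ltr1n//.
      by rewrite -EFinB -EFinM lee_fin; lra.
    apply: ge0_le_integral => //.
    - by move=> t _; rewrite lee_fin divr_ge0 ?expR_ge0.
    - exact: mg.
    - move=> t /=; rewrite in_itv/= lee_fin => /andP[t1 t2].
      have t0 : 0 < t by exact: lt_le_trans t1.
      rewrite /gamma_integrand mulrC ler_pM ?expR_ge0 ?invr_ge0//.
        rewrite powRB1// -[leLHS]mul1r ler_pM ?invr_ge0//.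
          have := @ge0_ler_powR R s (ltW s0) 1 t; rewrite powR1 !nnegrE.
          by apply => //; exact: ltW.
        by rewrite lef_pV2 ?posrE.
      by rewrite ler_expR lerN2.
  apply: ge0_subset_integral;
    [by []|by []|exact: mg|by move=> t _; rewrite lee_fin|].
  by move=> t /=; rewrite !in_itv/= => /andP[t1 _]; rewrite (lt_le_trans _ t1).
rewrite /Gamma fine_gt0// Ilty andbT; apply: lt_le_trans Ipos.
by rewrite lte_fin divr_gt0 ?expR_gt0.
Qed.
End gamma.

(** * The Euclidean norm and its behaviour under reflection *)

Section enorm_theory.
Context {R : realType}.
Implicit Types (n : nat) (alpha lambda : R).
Local Notation TR := (measurableTypeR R).

Lemma frac_const_gt0 n alpha : 0 < alpha < 2 -> 0 < frac_const n alpha :> R.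
Proof.
move=> /andP[a0 a2]; rewrite /frac_const divr_gt0// !mulr_gt0//.
- by apply: Gamma_gt0; rewrite divr_gt0// ltr_wpDl.
- by rewrite powR_gt0// pi_gt0.
- by apply: Gamma_gt0; lra.
Qed.

Lemma enorm_ge0 n (x : 'rV[R]_n) : 0 <= enorm x.
Proof. exact: sqrtr_ge0. Qed.

Lemma enorm_sqr n (x : 'rV[R]_n) : enorm x ^+ 2 = \sum_(i < n) x 0 i ^+ 2.
Proof. by rewrite sqr_sqrtr// sumr_ge0// => i _; exact: sqr_ge0. Qed.

Lemma ler_enorm_coord n (x : 'rV[R]_n) i : `|x 0 i| <= enorm x.
Proof.
rewrite -sqrtr_sqr ler_wsqrtr// (bigD1 i)//= lerDl sumr_ge0// => j _.
exact: sqr_ge0.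
Qed.

Lemma ler_enorm n (x : 'rV[R]_n) c : 0 <= c -> (forall i, `|x 0 i| <= c) ->
  enorm x <= Num.sqrt n%:R * c.
Proof.
move=> c0 xc; rewrite -[X in _ * X]ger0_norm// -sqrtr_sqr -sqrtrM ?ler0n//.
rewrite ler_wsqrtr//; apply: (@le_trans _ _ (\sum_(i < n) c ^+ 2)).
  by apply: ler_sum => i _; rewrite -real_normK ?num_real// lerXn2r ?nnegrE.
by rewrite sumr_const card_ord mulr_natl.
Qed.

Lemma enormN n (x : 'rV[R]_n) : enorm (- x) = enorm x.
Proof. by congr Num.sqrt; apply: eq_bigr => i _; rewrite mxE sqrrN. Qed.

(** A stand-in for the triangle inequality: in each coordinate the two sides differ by the square of
    [2 * x 0 i - y 0 i]. *)
Lemma enorm_sqr_le n (x y : 'rV[R]_n) :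
  enorm y ^+ 2 <= 2 * enorm x ^+ 2 + 2 * enorm (x - y) ^+ 2.
Proof.
rewrite !enorm_sqr !mulr_sumr -big_split/=; apply: ler_sum => i _.
by rewrite !mxE; have := sqr_ge0 (x 0 i + (x 0 i - y 0 i)); nra.
Qed.

Lemma reflectionK n lambda : involutive (@reflection R n lambda).
Proof.
by move=> x; apply/rowP => i; rewrite !mxE; case: (i == _) => //=; rewrite subKr.
Qed.

Lemma enorm_reflectionB n lambda (x y : 'rV[R]_n.+1) :
  enorm (reflection lambda x - reflection lambda y) = enorm (x - y).
Proof.
congr Num.sqrt; apply: eq_bigr => i _; rewrite !mxE; case: (i == _) => //=; ring.
Qed.

(** Only the first coordinate changes, and there the mirror image is farther. This is the source of
    the monotonicity of the kernel across the hyperplane. *)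
Lemma enorm_reflection_ge n lambda (x y : 'rV[R]_n.+1) :
  x 0 ord0 <= lambda -> y 0 ord0 <= lambda ->
  enorm (x - y) <= enorm (x - reflection lambda y).
Proof.
move=> xl yl; rewrite ler_wsqrtr//; apply: ler_sum => i _; rewrite !mxE.
by case: eqP => [->|_] //; nra.
Qed.

(** The topology comes from the sup norm, which is dominated by [enorm]. *)
Lemma enorm_lt_nbhs n (x : 'rV[R]_n) (P : set 'rV[R]_n) : nbhs x P ->
  exists2 e, 0 < e & forall y, enorm (x - y) < e -> P y.
Proof.
move=> /nbhs_ballP[e /= e0 eP]; exists e => // y xy; apply: eP; split=> // i j.
rewrite ord1 /ball /=; apply: le_lt_trans xy.
by have := ler_enorm_coord (x - y) j; rewrite !mxE.
Qed.

Lemma measurable_enorm_row_of n (x : 'rV[R]_n) :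
  measurable_fun [set: n.-tuple TR] (fun t => enorm (x - row_of t)).
Proof.
have -> : (fun t => enorm (x - row_of t)) = @Num.sqrt R \o
    (fun t : n.-tuple TR => \sum_(i < n) (x 0 i - tnth t i) ^+ 2).
  by apply/funext => t; congr Num.sqrt; apply: eq_bigr => i _; rewrite !mxE.
apply: measurableT_comp.
  by apply: continuous_measurable_fun; exact: sqrt_continuous.
apply: measurable_sum => i; apply: measurable_funX; apply: measurable_funB => //.
exact: measurable_tnth.
Qed.
End enorm_theory.

(** * The singular kernel *)

Section kernel.
Context {R : realType}.
Implicit Types (n : nat) (alpha delta : R).
Local Notation TR := (measurableTypeR R).

Definition kern n alpha (z : 'rV[R]_n) : R := (enorm z `^ (n%:R + alpha))^-1.

Lemma kern_ge0 n alpha (z : 'rV[R]_n) : 0 <= kern alpha z.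
Proof. by rewrite invr_ge0 powR_ge0. Qed.

(** The origin has to be excluded: the inverse of 0 is 0, so [kern] vanishes there instead of being
    infinite. *)
Lemma ler_kern n alpha (z z' : 'rV[R]_n) : 0 < alpha -> 0 < enorm z ->
  enorm z <= enorm z' -> kern alpha z' <= kern alpha z.
Proof.
move=> a0 z0 zz'; have z'0 := lt_le_trans z0 zz'.
rewrite /kern lef_pV2 ?posrE ?powR_gt0//.
by rewrite ge0_ler_powR ?nnegrE ?enorm_ge0// addr_ge0// ltW.
Qed.

Lemma measurable_kern n alpha (x : 'rV[R]_n) :
  measurable_fun [set: n.-tuple TR] (fun t => kern alpha (x - row_of t)).
Proof.
rewrite (_ : (fun t => _) = (fun r => r `^ (- (n%:R + alpha))) \o
    (fun t : n.-tuple TR => enorm (x - row_of t))); last first.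
  by apply/funext => t; rewrite /kern /= powRN.
by apply: measurableT_comp; [exact: measurable_powR|exact: measurable_enorm_row_of].
Qed.

Definition far n delta (x : 'rV[R]_n) : set (n.-tuple TR) :=
  [set t | delta <= enorm (x - row_of t)].

Lemma measurable_far n delta (x : 'rV[R]_n) : measurable (far delta x).
Proof.
rewrite -[far _ _]setTI.
have := measurable_enorm_row_of x => /(_ measurableT `[delta, +oo[%classic).
rewrite (_ : _ @^-1` _ = far delta x); first exact.
by apply/seteqP; split => t /=; rewrite /far/= in_itv/= andbT.
Qed.

(** The types of the ends are left free: cubes open on the right enclose the dyadic shells below,
    cubes open on the left serve as [corner_cube]. *)
Lemma lebesgue_tuple_cube n (c : 'rV[R]_n) (x0 x1 : R) (b0 b1 : bool) : x0 < x1 ->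
  lebesgue_tuple n [set t | forall i,
    tnth t i \in Interval (BSide b0 (c 0 i + x0)) (BSide b1 (c 0 i + x1))] =
  ((x1 - x0) ^+ n)%:E.
Proof.
move=> x01; pose A i := [set` Interval (BSide b0 (c 0 i + x0)) (BSide b1 (c 0 i + x1))].
rewrite (@lebesgue_tuple_box R n A)/=; last by move=> i; exact: measurable_itv.
rewrite (eq_bigr (fun=> (x1 - x0)%:E)); last first.
  move=> i _; rewrite /A lebesgue_measure_itv/= lte_fin ltrD2l x01 -EFinB.
  by congr (_%:E); ring.
by rewrite prodEFin prodr_const card_ord.
Qed.

Lemma measurable_cube n (c : 'rV[R]_n) (x0 x1 : R) (b0 b1 : bool) :
  measurable [set t : n.-tuple TR | forall i,
    tnth t i \in Interval (BSide b0 (c 0 i + x0)) (BSide b1 (c 0 i + x1))].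
Proof.
rewrite (_ : [set t | _] = \bigcap_(i in [set: 'I_n]) ((fun t : n.-tuple TR => tnth t i)
   @^-1` [set` Interval (BSide b0 (c 0 i + x0)) (BSide b1 (c 0 i + x1))])).
  apply: fin_bigcap_measurable => // i _; rewrite -[X in measurable X]setTI.
  exact: measurable_tnth.
by apply/seteqP; split => t /= At i; [move=> _|]; exact: At.
Qed.

Lemma kern_far_integral_le n alpha delta (x : 'rV[R]_n) : 0 < alpha -> 0 < delta ->
  (\int[lebesgue_tuple n]_(t in far delta x) (kern alpha (x - row_of t))%:E <=
   (4 ^+ n / (1 - 2 `^ (- alpha)) * delta `^ (- alpha))%:E)%E.
Proof.
move=> a0 d0.
pose B k := [set t : n.-tuple TR | forall i, tnth t i \in Interval
  (BSide true (x 0 i + - (2 ^+ k.+1 * delta))) (BSide true (x 0 i + 2 ^+ k.+1 * delta))].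
pose E k := far (2 ^+ k * delta) x `&` B k.
pose c k : R := (2 ^+ k * delta) `^ (- (n%:R + alpha)).
have y0 k : 0 < 2 ^+ k * delta by rewrite mulr_gt0 ?exprn_gt0.
rewrite mulrAC.
apply: (@ge0_integral_le_geometric _ _ R (lebesgue_tuple n) _ E _ c
  (4 ^+ n * delta `^ (- alpha)) (2 `^ (- alpha))).
- exact: measurable_far.
- by move=> k; apply: measurableI; [exact: measurable_far|exact: measurable_cube].
- move=> t dt; have [|k /andP[k1 k2]] := @dyadic_floor R (enorm (x - row_of t)) delta.
    by rewrite d0.
  exists k => //; split => // i.
  have := ler_enorm_coord (x - row_of t) i; rewrite !mxE => /le_lt_trans /(_ k2).
  by rewrite in_itv/= ltr_norml => /andP[? ?]; apply/andP; split; lra.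
- by apply: measurable_funTS; exact: measurable_kern.
- by move=> t _; exact: kern_ge0.
- move=> k t _ [kt _]; rewrite /c powRN lef_pV2 ?posrE ?powR_gt0//.
    by rewrite ge0_ler_powR ?nnegrE ?enorm_ge0 ?(ltW (y0 k)) ?addr_ge0 ?(ltW a0).
  exact: lt_le_trans kt.
- by move=> k; rewrite powR_ge0.
- move=> k; apply: (@le_trans _ _ ((c k)%:E * lebesgue_tuple n (B k))%E).
    rewrite lee_wpmul2l ?lee_fin ?powR_ge0// le_measure ?inE//.
    + by apply: measurableI; [exact: measurable_far|exact: measurable_cube].
    + exact: measurable_cube.
    + by move=> t [].
  rewrite lebesgue_tuple_cube; last first.
    by rewrite ltNge; apply/negP => h; have := y0 k.+1; lra.
  rewrite -EFinM lee_fin /c.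
  have -> : 2 ^+ k.+1 * delta - - (2 ^+ k.+1 * delta) = 4 * (2 ^+ k * delta).
    by rewrite exprS; ring.
  rewrite exprMn opprD powRD; last by rewrite (gt_eqF (y0 k)) implybT.
  rewrite powR_invn ?(ltW (y0 k))// powRM ?exprn_ge0 ?(ltW d0)//.
  rewrite -[in (2 ^+ k) `^ _]powR_mulrn// powRAC powR_mulrn ?powR_ge0//.
  have h : (2 ^+ k * delta) ^+ n != 0 by rewrite expf_eq0 (gt_eqF (y0 k)) andbF.
  by rewrite le_eqVlt; apply/orP; left; apply/eqP; field.
- rewrite powR_gt0//= powRN invf_lt1 ?powR_gt0//.
  by have := @gt0_ltr_powR R alpha a0 1 2; rewrite powR1 !nnegrE; apply; rewrite ?ltr1n.
Qed.
End kernel.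

(** * Integrability of the difference quotient away from its singularity *)

Section integrability.
Context {R : realType}.
Implicit Types (n : nat) (alpha delta lambda : R).
Local Notation TR := (measurableTypeR R).

Lemma frac_quotientE n alpha (u : 'rV[R]_n -> R) x y :
  frac_quotient alpha u x y = (u x - u y) * kern alpha (x - y).
Proof. by []. Qed.

Lemma integrable_kern n alpha delta (x : 'rV[R]_n) (D : set (n.-tuple TR)) :
  0 < alpha -> 0 < delta -> measurable D -> D `<=` far delta x ->
  (lebesgue_tuple n).-integrable D (fun t => (kern alpha (x - row_of t))%:E).
Proof.
move=> a0 d0 mD Dfar.
apply: (integrableS (measurable_far delta x)) => //.
apply/integrableP; split.
  by apply/measurable_EFinP; apply: measurable_funTS; exact: measurable_kern.
under eq_integral do rewrite gee0_abs ?lee_fin ?kern_ge0//.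
by apply: le_lt_trans (kern_far_integral_le x a0 d0) _; rewrite ltry.
Qed.

Lemma integral_kern_le n alpha delta (x : 'rV[R]_n) (D : set (n.-tuple TR)) :
  0 < alpha -> 0 < delta -> measurable D -> D `<=` far delta x ->
  (\int[lebesgue_tuple n]_(t in D) (kern alpha (x - row_of t))%:E <=
   (4 ^+ n / (1 - 2 `^ (- alpha)) * delta `^ (- alpha))%:E)%E.
Proof.
move=> a0 d0 mD Dfar; apply: le_trans (kern_far_integral_le x a0 d0).
apply: ge0_subset_integral => //; first exact: measurable_far.
- by apply/measurable_EFinP; apply: measurable_funTS; exact: measurable_kern.
- by move=> t _; rewrite lee_fin kern_ge0.
Qed.

(** [L_space] only speaks of the weighted absolute value; positivity removes the absolute value, and
    multiplying by the weight recovers [u]. *)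
Lemma L_space_measurable n alpha (u : 'rV[R]_n -> R) : (forall x, 0 < u x) ->
  L_space alpha u -> measurable_fun [set: n.-tuple TR] (u \o @row_of R n).
Proof.
move=> u0 /measurable_int/measurable_EFinP mu.
rewrite (_ : u \o _ = (fun t : n.-tuple TR => `|u (row_of t)| /
    (1 + enorm (row_of t) `^ (n%:R + alpha))) \*
    (fun t : n.-tuple TR => 1 + enorm (row_of t) `^ (n%:R + alpha))); last first.
  apply/funext => t /=; rewrite divfK ?gtr0_norm//.
  by rewrite gt_eqF// ltr_pwDl// powR_ge0.
apply: measurable_funM => //; apply: measurable_funD => //.
rewrite (_ : (fun t : n.-tuple TR => _) = (fun r => r `^ (n%:R + alpha)) \o
    (fun t : n.-tuple TR => enorm (0 - row_of t))); last first.
  by apply/funext => t /=; rewrite sub0r enormN.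
by apply: measurableT_comp; [exact: measurable_powR|exact: measurable_enorm_row_of].
Qed.

(** Compares the kernel with the weight of [L_space]: away from [x], both 1 and [enorm y] are
    bounded by multiples of [enorm (x - y)]. *)
Lemma kern_far_le n alpha delta (x : 'rV[R]_n) : 0 < alpha -> 0 < delta ->
  exists M, forall y, delta <= enorm (x - y) ->
    kern alpha (x - y) <= M / (1 + enorm y `^ (n%:R + alpha)).
Proof.
move=> a0 d0; pose s := n%:R + alpha.
have s0 : 0 < s by rewrite ltr_wpDl.
(* [A] comes from [enorm_sqr_le], with [enorm x ^+ 2] absorbed through [delta <= enorm (x - y)]. *)
pose A := Num.sqrt (2 * enorm x ^+ 2 / delta ^+ 2 + 2).
exists (delta `^ (- s) + A `^ s) => y dy.
have r0 := lt_le_trans d0 dy; set r := enorm (x - y) in dy r0 *.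
have yA : enorm y <= A * r.
  rewrite -[leLHS]ger0_norm ?enorm_ge0// -sqrtr_sqr -[r in _ * r]ger0_norm ?(ltW r0)//.
  rewrite -sqrtr_sqr -sqrtrM; last first.
    by rewrite addr_ge0// divr_ge0 ?sqr_ge0// mulr_ge0// sqr_ge0.
  apply: ler_wsqrtr; apply: le_trans (enorm_sqr_le x y) _.
  rewrite [leRHS]mulrDl; apply: lerD => //.
  rewrite mulrAC ler_pdivlMr ?exprn_gt0// ler_wpM2l ?mulr_ge0 ?enorm_ge0//.
  by rewrite lerXn2r ?nnegrE ?(ltW d0) ?(ltW r0).
have p0 : 0 < 1 + enorm y `^ s by rewrite ltr_pwDl// powR_ge0.
have -> : kern alpha (x - y) = (r `^ s)^-1 by [].
rewrite (ler_pdivlMr _ _ p0) mulrC (ler_pdivrMr _ _ (powR_gt0 s r0)) mulrDl; apply: lerD.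
  rewrite powRN mulrC ler_pdivlMr ?powR_gt0// mul1r.
  by rewrite ge0_ler_powR ?nnegrE ?(ltW d0) ?(ltW r0) ?(ltW s0).
rewrite -powRM ?sqrtr_ge0 ?(ltW r0)//.
by rewrite ge0_ler_powR ?nnegrE ?mulr_ge0 ?enorm_ge0 ?sqrtr_ge0 ?(ltW r0) ?(ltW s0).
Qed.

Lemma integrable_L_space_kern n alpha delta (u : 'rV[R]_n -> R) (x : 'rV[R]_n)
    (D : set (n.-tuple TR)) :
  measurable_fun [set: n.-tuple TR] (u \o @row_of R n) -> L_space alpha u ->
  0 < alpha -> 0 < delta -> measurable D -> D `<=` far delta x ->
  (lebesgue_tuple n).-integrable D
    (fun t => (u (row_of t) * kern alpha (x - row_of t))%:E).
Proof.
move=> mu uL a0 d0 mD Dfar; have [M hM] := kern_far_le x a0 d0.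
pose w (t : n.-tuple TR) := `|u (row_of t)| / (1 + enorm (row_of t) `^ (n%:R + alpha)).
apply: (@le_integrable _ _ R _ _ mD _ (fun t => M%:E * (w t)%:E)%E).
- apply/measurable_EFinP; apply: measurable_funTS; apply: measurable_funM => //.
  exact: measurable_kern.
- move=> t /Dfar/hM h; rewrite -EFinM !abse_EFin lee_fin.
  apply: le_trans (ler_norm _); rewrite normrM [X in _ * X]ger0_norm ?kern_ge0//.
  by rewrite /w mulrCA ler_wpM2l.
- by apply: integrableZl => //; apply: integrableS uL.
Qed.

Lemma integrable_frac_quotient n alpha delta (u : 'rV[R]_n -> R) (c : R)
    (x : 'rV[R]_n) (D : set (n.-tuple TR)) :
  measurable_fun [set: n.-tuple TR] (u \o @row_of R n) -> L_space alpha u ->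
  0 < alpha -> 0 < delta -> measurable D -> D `<=` far delta x ->
  (lebesgue_tuple n).-integrable D
    (fun t => ((c - u (row_of t)) * kern alpha (x - row_of t))%:E).
Proof.
move=> mu uL a0 d0 mD Dfar.
rewrite (_ : (fun t => _) = (fun t => c%:E * (kern alpha (x - row_of t))%:E) \-
  (fun t => (u (row_of t) * kern alpha (x - row_of t))%:E))%E; last first.
  by apply/funext => t; rewrite /= -EFinM -EFinB mulrBl.
apply: integrableB => //.
  by apply: integrableZl => //; exact: integrable_kern Dfar.
exact: integrable_L_space_kern Dfar.
Qed.
End integrability.

(** * Change of variables under the reflection *)

Section reflection_integral.
Context {R : realType}.
Implicit Types (n : nat) (lambda : R).
Local Notation TR := (measurableTypeR R).

HB.instance Definition _ n lambda :=
  isMeasurableFun.Build _ _ _ _ (@reflect_tuple R n lambda)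
    (@measurable_reflect_tuple R n lambda).

Local Notation mu n := (lebesgue_tuple n).

Lemma measurable_reflect_preimage n lambda (D : set (n.+1.-tuple TR)) :
  measurable D -> measurable (reflect_tuple lambda @^-1` D).
Proof.
by move=> mD; rewrite -[X in measurable X]setTI; exact: measurable_reflect_tuple.
Qed.

Lemma integrable_reflect n lambda (D : set (n.+1.-tuple TR)) (F : n.+1.-tuple TR -> R) :
  measurable D -> measurable_fun setT F ->
  (mu n.+1).-integrable D (fun t => (F t)%:E) ->
  (mu n.+1).-integrable (reflect_tuple lambda @^-1` D)
    (fun t => (F (reflect_tuple lambda t))%:E).
Proof.
move=> mD mF /integrableP[_ Foo]; apply/integrableP; split.
  apply/measurable_EFinP; apply: measurable_funTS; apply: measurableT_comp => //.
rewrite -(ge0_integral_pushforward (@measurable_reflect_tuple R n lambda) _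
  mD (f := fun t => `|(F t)%:E|%E)).
- rewrite (eq_measure_integral (mu n.+1))// => A mA _.
  exact: lebesgue_tuple_reflect.
- by apply: measurable_funTS; apply: measurableT_comp => //; exact/measurable_EFinP.
- by move=> t _; exact: abse_ge0.
Qed.

Lemma integral_reflect n lambda (D : set (n.+1.-tuple TR)) (F : n.+1.-tuple TR -> R) :
  measurable D -> measurable_fun setT F ->
  (mu n.+1).-integrable D (fun t => (F t)%:E) ->
  (\int[mu n.+1]_(t in reflect_tuple lambda @^-1` D) (F (reflect_tuple lambda t))%:E =
   \int[mu n.+1]_(t in D) (F t)%:E)%E.
Proof.
move=> mD mF iF; symmetry.
rewrite (eq_measure_integral (pushforward (mu n.+1) (reflect_tuple lambda))); last first.
  by move=> A mA _; symmetry; exact: lebesgue_tuple_reflect.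
rewrite (integral_pushforward (@measurable_reflect_tuple R n lambda))//.
  exact/measurable_EFinP.
exact: integrable_reflect.
Qed.

(** On an invariant domain twice the integral of [F] is the integral of [F] plus its reflection,
    hence at most [2 * c] times the measure of [Q]. *)
Lemma integral_reflect_le n lambda (D Q : set (n.+1.-tuple TR)) (F : n.+1.-tuple TR -> R)
    (c q : R) :
  measurable D -> measurable Q -> Q `<=` D ->
  reflect_tuple lambda @^-1` D = D -> measurable_fun setT F ->
  (mu n.+1).-integrable D (fun t => (F t)%:E) -> mu n.+1 Q = q%:E ->
  (forall t, D t -> F t + F (reflect_tuple lambda t) <= 2 * c * \1_Q t) ->
  (\int[mu n.+1]_(t in D) (F t)%:E <= (c * q)%:E)%E.
Proof.
move=> mD mQ QD DD mF iF Qq Fle.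
have iFr := integrable_reflect lambda mD mF iF; rewrite DD in iFr.
have := integral_reflect lambda mD mF iF; rewrite DD => Frr.
have IQ : (\int[mu n.+1]_(t in D) ((\1_Q t)%:E : \bar R))%E = q%:E.
  by rewrite integral_indic// setIidl//; exact: Qq.
have iQ : (mu n.+1).-integrable D (fun t => ((\1_Q t)%:E : \bar R)).
  apply/integrableP; split.
    by apply/measurable_EFinP; apply: measurable_funTS; exact: measurable_indic.
  under eq_integral do rewrite gee0_abs ?lee_fin//.
  by rewrite IQ ltry.
have := integrable_fin_num mD iF.
have : (\int[mu n.+1]_(t in D) ((F t)%:E + (F (reflect_tuple lambda t))%:E) <=
       \int[mu n.+1]_(t in D) ((2 * c)%:E * (\1_Q t)%:E))%E.
  apply: le_integral => //.
  - exact: integrableD.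
  - exact: integrableZl.
  (* What remains is to halve the inequality, which is legitimate because the integral of [F] is
     finite. *)
  - by move=> t /set_mem Dt; rewrite -EFinD -EFinM lee_fin; apply: Fle.
rewrite integralD// integralZl// Frr IQ.
case: (integral _ _ _) => // r; rewrite -EFinD -EFinM !lee_fin => h _.
by move: h; lra.
Qed.
End reflection_integral.

(** * Comparison at a negative minimum *)

Lemma integrable_integralB d (T : measurableType d) (R : realType)
    (mu : {measure set T -> \bar R}) (D : set T) (F G K : T -> R) :
  measurable D -> mu.-integrable D (fun t => (F t)%:E) ->
  mu.-integrable D (fun t => (G t)%:E) -> (forall t, K t = F t - G t) ->
  mu.-integrable D (fun t => (K t)%:E) /\
  (\int[mu]_(t in D) (K t)%:E =
   \int[mu]_(t in D) (F t)%:E - \int[mu]_(t in D) (G t)%:E)%E.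
Proof.
move=> mD iF iG KE.
have -> : (fun t => (K t)%:E) = ((fun t => (F t)%:E) \- (fun t => (G t)%:E))%E.
  by apply/funext => t; rewrite KE EFinB.
by split; [exact: integrableB|exact: integralB].
Qed.

Section antisymmetric.
Context {R : realType}.
Implicit Types (n : nat) (alpha delta lambda rho : R).
Local Notation TR := (measurableTypeR R).
Local Notation mu n := (lebesgue_tuple n).

(* The points of [corner_cube rho x] are within [2 rho sqrt n] of [x], whence a
   kernel at least [kappa n alpha * rho `^ (- (n + alpha))] there. *)
Definition kappa n alpha : R := ((2 * Num.sqrt n%:R) `^ (n%:R + alpha))^-1.

Lemma kappa_gt0 n alpha : 0 < kappa n.+1 alpha.
Proof. by rewrite invr_gt0 powR_gt0// mulr_gt0// sqrtr_gt0. Qed.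

Definition corner_cube n rho (x : 'rV[R]_n) : set (n.-tuple TR) :=
  [set t | forall i, tnth t i \in `]x 0 i + rho, x 0 i + 2 * rho]].

Lemma measurable_corner_cube n rho (x : 'rV[R]_n) : measurable (corner_cube rho x).
Proof. exact: measurable_cube. Qed.

Lemma lebesgue_corner_cube n rho (x : 'rV[R]_n) : 0 < rho ->
  mu n (corner_cube rho x) = (rho ^+ n)%:E.
Proof.
move=> r0; rewrite lebesgue_tuple_cube; last by lra.
by congr (_ ^+ _)%:E; lra.
Qed.

Lemma kern_corner_cube n alpha rho (x : 'rV[R]_n.+1) t : 0 < alpha -> 0 < rho ->
  corner_cube rho x t ->
  kappa n.+1 alpha * rho `^ (- (n.+1%:R + alpha)) <= kern alpha (x - row_of t).
Proof.
move=> a0 r0 tQ; have s0 : 0 < n.+1%:R + alpha by rewrite ltr_wpDl.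
have e0 : 0 < enorm (x - row_of t).
  apply: lt_le_trans (ler_enorm_coord _ ord0); rewrite !mxE distrC.
  by apply: lt_le_trans (ler_norm _); move: (tQ ord0); rewrite in_itv/= => /andP[]; lra.
have le : enorm (x - row_of t) <= 2 * Num.sqrt n.+1%:R * rho.
  rewrite (mulrC 2) -mulrA; apply: ler_enorm; first by rewrite mulr_ge0// ltW.
  move=> i; rewrite !mxE ler_norml; move: (tQ i); rewrite in_itv/= => /andP[? ?].
  by apply/andP; split; lra.
rewrite /kappa /kern powRN -invfM -powRM ?(ltW r0) ?mulr_ge0 ?sqrtr_ge0//.
rewrite lef_pV2 ?posrE ?powR_gt0//; last exact: lt_le_trans le.
rewrite ge0_ler_powR ?nnegrE ?enorm_ge0 ?(ltW s0)//.
by rewrite mulr_ge0 ?(ltW r0)// mulr_ge0 ?sqrtr_ge0.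
Qed.

(** Pairs a point with its mirror image, where an odd function takes the values [w] and [- w]; [k1]
    is the kernel at the nearer of the two points. *)
Let two_kernels_le (m w k1 k2 : R) : m <= w -> k2 <= k1 ->
  (m - w) * k1 + (m + w) * k2 <= 2 * m * k2.
Proof.
move=> mw k21; rewrite -subr_ge0.
have -> : 2 * m * k2 - ((m - w) * k1 + (m + w) * k2) = (w - m) * (k1 - k2) by ring.
by rewrite mulr_ge0 ?subr_ge0.
Qed.

(** Each pair of mirror points contributes at most [2 * m] times the kernel at the farther one. This
    is nonpositive everywhere and quantitatively negative on [corner_cube rho x], which lies beyond
    the hyperplane. The bound [m] need not be the value of [w] at [x], so that [x] may later be
    moved off the minimum. *)
Lemma antisymmetric_integral_le n alpha lambda rho delta (m : R)
    (w : 'rV[R]_n.+1 -> R) (x : 'rV[R]_n.+1) (D : set (n.+1.-tuple TR)) :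
  0 < alpha -> 0 < rho -> 0 < delta -> measurable D ->
  reflect_tuple lambda @^-1` D = D -> D `<=` far delta x ->
  corner_cube rho x `<=` D ->
  x 0 ord0 <= lambda <= x 0 ord0 + rho -> m <= 0 ->
  (forall y, w (reflection lambda y) = - w y) ->
  (forall y : 'rV[R]_n.+1, y 0 ord0 <= lambda -> m <= w y) ->
  measurable_fun [set: n.+1.-tuple TR] (w \o @row_of R n.+1) ->
  (mu n.+1).-integrable D
    (fun t => ((m - w (row_of t)) * kern alpha (x - row_of t))%:E) ->
  (\int[mu n.+1]_(t in D) ((m - w (row_of t)) * kern alpha (x - row_of t))%:E <=
   (m * (kappa n.+1 alpha * rho `^ (- alpha)))%:E)%E.
Proof.
move=> a0 r0 d0 mD DD Dfar QD /andP[xl lx] m0 wN wm mw iF.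
(* Splits off the volume [rho ^+ n.+1] of the cube. *)
have -> : m * (kappa n.+1 alpha * rho `^ (- alpha)) =
    m * (kappa n.+1 alpha * rho `^ (- (n.+1%:R + alpha))) * rho ^+ n.+1.
  rewrite opprD powRD ?(gt_eqF r0) ?implybT// powR_invn ?(ltW r0)//.
  have h : rho ^+ n.+1 != 0 by rewrite expf_eq0 (gt_eqF r0).
  by field.
apply: (integral_reflect_le (lambda := lambda) mD (measurable_corner_cube rho x)) => //.
- apply: measurable_funM; last exact: measurable_kern.
  by apply: measurable_funB.
- exact: lebesgue_corner_cube.
move=> t Dt; rewrite !row_of_reflect wN opprK.
have far1 : 0 < enorm (x - row_of t) by apply: lt_le_trans d0 _; exact: Dfar.
have far2 : 0 < enorm (x - reflection lambda (row_of t)).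
  apply: lt_le_trans d0 _; rewrite -row_of_reflect; apply: Dfar.
  by move: Dt; rewrite -{1}DD.
(* On the near side the point is outside the cube, and the sign of [m] suffices. *)
have [yl|yl] := leP (row_of t 0 ord0) lambda.
  rewrite indicE memNset ?mulr0; last first.
    move=> /(_ ord0); rewrite in_itv/= => /andP[/(le_lt_trans lx)].
    by move: yl; rewrite mxE leNgt => /negP.
  have k21 := ler_kern a0 far1 (enorm_reflection_ge xl yl).
  apply: le_trans (two_kernels_le (wm _ yl) k21) _.
  by rewrite mulr_le0_ge0 ?kern_ge0// mulr_ge0_le0.
(* On the far side the pairing is applied to the mirror image; the farther point is now the given
   one, which may lie in the cube. *)
have yl' : (reflection lambda (row_of t)) 0 ord0 <= lambda.
  by move: yl => /ltW; rewrite !mxE/=; clear; lra.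
have := enorm_reflection_ge xl yl'; rewrite reflectionK => /(ler_kern a0 far2).
have := wm _ yl'; rewrite wN => wy /(two_kernels_le wy) h.
rewrite opprK addrC in h; apply: (le_trans h).
rewrite -!mulrA; apply: ler_wpM2l => //; apply: ler_wnM2l => //.
rewrite indicE; have [tQ|tQ] := boolP (t \in _); last by rewrite !mulr0 kern_ge0.
by rewrite mulr1; exact: kern_corner_cube (set_mem tQ).
Qed.

(** Distances are unchanged when both points are reflected, so the integral at the reflected point
    can be brought back to [D], where the two quotients subtract to that of [reflection_diff].
    Finiteness is recorded so that the subtraction can be used in the extended reals. *)
Lemma frac_quotient_reflection_diff n alpha lambda delta
    (u : 'rV[R]_n.+1 -> R) (x : 'rV[R]_n.+1) (D : set (n.+1.-tuple TR)) :
  measurable_fun [set: n.+1.-tuple TR] (u \o @row_of R n.+1) -> L_space alpha u ->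
  0 < alpha -> 0 < delta -> measurable D -> D `<=` far delta x ->
  [/\ (\int[mu n.+1]_(t in reflect_tuple lambda @^-1` D)
         (frac_quotient alpha u (reflection lambda x) (row_of t))%:E) \is a fin_num,
      (\int[mu n.+1]_(t in D) (frac_quotient alpha u x (row_of t))%:E) \is a fin_num,
      (mu n.+1).-integrable D
         (fun t => (frac_quotient alpha (reflection_diff lambda u) x (row_of t))%:E) &
      \int[mu n.+1]_(t in reflect_tuple lambda @^-1` D)
         (frac_quotient alpha u (reflection lambda x) (row_of t))%:E -
      \int[mu n.+1]_(t in D) (frac_quotient alpha u x (row_of t))%:E =
      \int[mu n.+1]_(t in D)
         (frac_quotient alpha (reflection_diff lambda u) x (row_of t))%:E]%E.
Proof.
move=> mU uL a0 d0 mD Dfar.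
pose F := fun t : n.+1.-tuple TR =>
  frac_quotient alpha u (reflection lambda x) (row_of t).
pose G := fun t : n.+1.-tuple TR => frac_quotient alpha u x (row_of t).
pose K := fun t : n.+1.-tuple TR =>
  frac_quotient alpha (reflection_diff lambda u) x (row_of t).
have mr := @measurable_reflect_preimage R n lambda D mD.
have DD : reflect_tuple lambda @^-1` (reflect_tuple lambda @^-1` D) = D.
  by apply/seteqP; split => t /=; rewrite reflect_tupleK.
have mF : measurable_fun setT F.
  by apply: measurable_funM; [exact: measurable_funB|exact: measurable_kern].
have iF : (mu n.+1).-integrable (reflect_tuple lambda @^-1` D)
    (fun t => (F t)%:E).
  apply: (integrable_frac_quotient _ mU uL a0 d0 mr) => t /Dfar.
  by rewrite /far/= row_of_reflect -(enorm_reflectionB lambda) reflectionK.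
have iG : (mu n.+1).-integrable D (fun t => (G t)%:E).
  exact: (integrable_frac_quotient _ mU uL a0 d0 mD Dfar).
have KE t : K t = F (reflect_tuple lambda t) - G t.
  rewrite /K /F /G !frac_quotientE row_of_reflect /kern enorm_reflectionB.
  by rewrite /reflection_diff; ring.
suff: [/\ (\int[mu n.+1]_(t in reflect_tuple lambda @^-1` D) (F t)%:E) \is a fin_num,
    (\int[mu n.+1]_(t in D) (G t)%:E) \is a fin_num,
    (mu n.+1).-integrable D (fun t => (K t)%:E) &
    \int[mu n.+1]_(t in reflect_tuple lambda @^-1` D) (F t)%:E -
    \int[mu n.+1]_(t in D) (G t)%:E = \int[mu n.+1]_(t in D) (K t)%:E]%E by [].
clearbody F G K.
have iFr := integrable_reflect lambda mr mF iF; rewrite DD in iFr.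
have := integral_reflect lambda mr mF iF; rewrite DD => Frr.
have [iK IK] := integrable_integralB mD iFr iG KE.
rewrite Frr in IK; symmetry in IK.
by split; [exact: integrable_fin_num iF|exact: integrable_fin_num iG|exact: iK|].
Qed.
End antisymmetric.

Lemma integral_EFin_le0 d (T : measurableType d) (R : realType)
    (mu : {measure set T -> \bar R}) (D : set T) (F : T -> R) :
  (forall t, D t -> F t <= 0) -> (\int[mu]_(t in D) (F t)%:E <= 0)%E.
Proof.
move=> F0; rewrite -oppe_ge0.
rewrite (eq_integral (fun t => - (- F t)%:E)%E); last first.
  by move=> t _; rewrite EFinN oppeK.
rewrite integral_ge0N ?oppeK; last by move=> t /F0; rewrite lee_fin oppr_ge0.
by apply: integral_ge0 => t /F0; rewrite lee_fin oppr_ge0.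
Qed.

Section comparison.
Context {R : realType}.
Implicit Types (n : nat) (alpha delta lambda rho : R).
Local Notation TR := (measurableTypeR R).
Local Notation mu n := (lebesgue_tuple n).

Lemma reflection_diffN n lambda (u : 'rV[R]_n.+1 -> R) y :
  reflection_diff lambda u (reflection lambda y) = - reflection_diff lambda u y.
Proof. by rewrite /reflection_diff reflectionK opprB. Qed.

Lemma measurable_reflection_diff n lambda (u : 'rV[R]_n.+1 -> R) :
  measurable_fun [set: n.+1.-tuple TR] (u \o @row_of R n.+1) ->
  measurable_fun [set: n.+1.-tuple TR] (reflection_diff lambda u \o @row_of R n.+1).
Proof.
move=> mU; rewrite (_ : _ \o _ =
    ((u \o @row_of R n.+1) \o @reflect_tuple R n lambda) \- (u \o @row_of R n.+1)).
  apply: measurable_funB => //.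
  by apply: (measurableT_comp mU); exact: measurable_reflect_tuple.
by apply/funext => t; rewrite /= row_of_reflect.
Qed.

(** A small shift to the left enters the open half space. This turns minimality over the closure
    into a plain inequality on first coordinates. *)
Lemma closure_left_half_space n lambda (y : 'rV[R]_n.+1) :
  y 0 ord0 <= lambda -> closure (@left_half_space R n lambda) y.
Proof.
move=> yl B /enorm_lt_nbhs[e e0 eB].
exists (y - (e / 2) *: delta_mx 0 ord0); split.
  by rewrite /left_half_space/= !mxE !eqxx mulr1; lra.
apply: eB; rewrite opprB addrC subrK /enorm (bigD1 ord0)//= big1 ?addr0.
  by rewrite !mxE !eqxx mulr1 sqrtr_sqr ger0_norm; lra.
by move=> i i0; rewrite !mxE (negbTE i0) andbF mulr0 expr0n.
Qed.

(* The ball around the reflected point, where the difference is positive, is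
   discarded so that the remaining domain is symmetric. *)
Lemma frac_laplacian_reflection_le n alpha lambda rho (u : 'rV[R]_n.+2 -> R)
    (x : 'rV[R]_n.+2) (A B : R) :
  0 < alpha < 2 -> 0 < rho -> x 0 ord0 <= lambda <= x 0 ord0 + rho ->
  measurable_fun [set: n.+2.-tuple TR] (u \o @row_of R n.+2) -> L_space alpha u ->
  {for reflection lambda x, continuous (reflection_diff lambda u)} ->
  (forall y : 'rV[R]_n.+2, y 0 ord0 <= lambda ->
    reflection_diff lambda u x <= reflection_diff lambda u y) ->
  reflection_diff lambda u x < 0 ->
  is_frac_laplacian alpha u x A ->
  is_frac_laplacian alpha u (reflection lambda x) B ->
  B - A <= frac_const n.+2 alpha * (kappa n.+2 alpha * rho `^ (- alpha)) *
    reflection_diff lambda u x.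
Proof.
move=> a02 r0 xl mU uL cU Umin U0 uA uB; have /andP[a0 _] := a02.
set U := reflection_diff lambda u in cU Umin U0 *.
have C0 := frac_const_gt0 n.+2 a02; set C := frac_const n.+2 alpha in C0 *.
(* At the reflected point [U] equals [- U x], which is positive, so it stays positive on a ball of
   some radius [e0]. *)
have [e0 e00 e0U] : exists2 e, 0 < e &
    forall y, enorm (reflection lambda x - y) < e -> 0 < U y.
  apply: enorm_lt_nbhs; apply: (cvgr_gt _ cU).
  by rewrite /U reflection_diffN oppr_gt0.
have uBA := cvgeB (isT : (B%:E +? - A%:E)%E) uB uA.
move/(_ ltac:(exact _)): uBA; rewrite -EFinB => uBA.
(* The bound does not depend on the truncation radius, so it suffices to prove it for all small
   radii. *)
rewrite -lee_fin; apply: (cvge_le _ uBA) => {uBA}.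
near=> e.
have ep : 0 < e by near: e; exact: nbhs_right_gt.
have ee0 : e < e0 by near: e; exact: nbhs_right_lt.
have er : e < rho by near: e; exact: nbhs_right_lt.
have mfar := measurable_far e x.
have [] := frac_quotient_reflection_diff lambda mU uL a0 ep mfar (fun=> id).
have -> : reflect_tuple lambda @^-1` far e x =
    @row_of R n.+2 @^-1` [set y | e <= enorm (reflection lambda x - y)].
  by apply/seteqP; split => t /=; rewrite /far/= row_of_reflect
    -(enorm_reflectionB lambda) reflectionK.
rewrite -/(integral_Rn [set y | e <= enorm (reflection lambda x - y)] _).
rewrite -/(integral_Rn [set y | e <= enorm (x - y)] (frac_quotient alpha u x)).
set IB := integral_Rn _ _; set IA := integral_Rn _ _ => fB fA iK IK.
suff : ((IB - IA) <= (U x * (kappa n.+2 alpha * rho `^ (- alpha)))%:E)%E.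
  move: fB fA; case: IB {IK} => // b _; case: IA => // c _.
  rewrite -EFinB -!EFinM -EFinB !lee_fin -mulrBr -mulrA => h.
  by rewrite ler_pM2l// mulrC.
rewrite {}IK.
pose D := far e x `&` reflect_tuple lambda @^-1` far e x.
have mD : measurable D by apply: measurableI => //; exact: measurable_reflect_preimage.
have DE : D `|` (far e x `\` D) = far e x by rewrite setDUK// => t [].
have mDc : measurable (far e x `\` D) by exact: measurableD.
rewrite -{1}DE integral_setU//; last 2 first.
- by rewrite DE; exact: measurable_int iK.
- by rewrite disj_set2E; apply/eqP/seteqP; split => // t [Dt []].
(* On the discarded piece, within [e] of the reflected point, [U] is positive while [U x] is
   negative: the integrand is nonpositive. *)
rewrite -[leRHS]adde0; apply: leeD; last first.
  apply: integral_EFin_le0 => t [et Dt]; rewrite frac_quotientE.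
  rewrite mulr_le0_ge0 ?kern_ge0// subr_le0; apply: ltW; apply: lt_trans U0 _.
  apply: e0U; apply: lt_trans ee0; rewrite ltNge; apply/negP => h.
  apply: Dt; split => //.
  by rewrite /far/= row_of_reflect -(enorm_reflectionB lambda) reflectionK.
apply: (antisymmetric_integral_le (lambda := lambda) (delta := e)) => //.
- by apply/seteqP; split => t [] /=; rewrite /D/= reflect_tupleK.
- by move=> t [].
(* The last coordinate, shared by [x] and its reflection, already separates the cube from both
   points by [rho], which exceeds [e]. *)
- move=> t tQ; split.
    rewrite /far/=; apply: le_trans (ler_enorm_coord _ ord_max).
    move: (tQ ord_max); rewrite !mxE in_itv/= distrC => /andP[h _].
    by apply: le_trans (ler_norm _); lra.
  rewrite /far/= row_of_reflect; apply: le_trans (ler_enorm_coord _ ord_max).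
  move: (tQ ord_max); rewrite !mxE/= in_itv/= distrC => /andP[h _].
  by apply: le_trans (ler_norm _); lra.
- exact: ltW.
- exact: reflection_diffN.
- exact: measurable_reflection_diff.
- by apply: (integrableS mfar mD _ iK) => t [].
Unshelve. all: by end_near.
Qed.
End comparison.

(** * Comparison for the nonlocal normal derivative *)

Section normal_comparison.
Context {R : realType}.
Implicit Types (n : nat) (alpha delta lambda rho theta : R).
Local Notation TR := (measurableTypeR R).
Local Notation mu n := (lebesgue_tuple n).

Local Notation upper n :=
  (@row_of R n.+1 @^-1` @upper_half_space R n : set (n.+1.-tuple TR)).

Let measurable_upper n : measurable (upper n).
Proof.
have := @measurable_tnth _ TR n.+1 ord_max measurableT `]0, +oo[%classic.
rewrite setTI (_ : _ @^-1` _ = upper n); first by apply.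
by apply/seteqP; split => t /=; rewrite /upper_half_space/= mxE in_itv/= andbT.
Qed.

Let reflect_upper n lambda : reflect_tuple lambda @^-1` upper n.+1 = upper n.+1.
Proof.
by apply/seteqP; split => t; rewrite /= row_of_reflect /upper_half_space/= !mxE.
Qed.

Let upper_far n delta (x : 'rV[R]_n.+1) : x 0 ord_max <= - delta ->
  upper n `<=` far delta x.
Proof.
move=> xd t; rewrite /far /= /upper_half_space /= mxE => t0.
apply: le_trans (ler_enorm_coord _ ord_max); rewrite !mxE distrC.
by apply: le_trans (ler_norm _); lra.
Qed.

(** Split [U x - U y] as [(U x - m) + (m - U y)]. The first term costs its value times the kernel
    mass of the half space, seen from depth [delta]; the second falls under the antisymmetric
    estimate, the half space being invariant under the reflection. *)
Lemma nonlocal_normal_reflection_le n alpha lambda rho delta (m : R)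
    (u : 'rV[R]_n.+2 -> R) (x : 'rV[R]_n.+2) (A B : R) :
  0 < alpha < 2 -> 0 < rho -> 0 < delta -> x 0 ord0 <= lambda <= x 0 ord0 + rho ->
  x 0 ord_max <= - delta -> 0 <= x 0 ord_max + rho ->
  measurable_fun [set: n.+2.-tuple TR] (u \o @row_of R n.+2) -> L_space alpha u ->
  m <= 0 -> m <= reflection_diff lambda u x ->
  (forall y : 'rV[R]_n.+2, y 0 ord0 <= lambda -> m <= reflection_diff lambda u y) ->
  nonlocal_normal alpha u x = A%:E ->
  nonlocal_normal alpha u (reflection lambda x) = B%:E ->
  B - A <= frac_const n.+2 alpha * ((reflection_diff lambda u x - m) *
      (4 ^+ n.+2 / (1 - 2 `^ (- alpha)) * delta `^ (- alpha)) +
    m * (kappa n.+2 alpha * rho `^ (- alpha))).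
Proof.
move=> a02 r0 d0 xl xd xr mU uL m0 mUx mUy uA uB; have /andP[a0 _] := a02.
set U := reflection_diff lambda u in mUx mUy *.
have C0 := frac_const_gt0 n.+2 a02; set C := frac_const n.+2 alpha in C0 *.
have Dfar := upper_far xd.
pose IB := integral_Rn (@upper_half_space R n.+1)
  (frac_quotient alpha u (reflection lambda x)).
pose IA := integral_Rn (@upper_half_space R n.+1) (frac_quotient alpha u x).
have [fB fA iK IK] : [/\ IB \is a fin_num, IA \is a fin_num,
    (mu n.+2).-integrable (upper n.+1)
      (fun t => (frac_quotient alpha U x (row_of t))%:E) &
    IB - IA = \int[mu n.+2]_(t in upper n.+1)
      (frac_quotient alpha U x (row_of t))%:E]%E.
  have := frac_quotient_reflection_diff lambda mU uL a0 d0 (@measurable_upper n.+1) Dfar.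
  by rewrite reflect_upper; exact.
have {}uA : (C%:E * IA)%E = A%:E by exact: uA.
have {}uB : (C%:E * IB)%E = B%:E by exact: uB.
have -> : B - A = C * fine (IB - IA).
  clear IK iK; clearbody IA IB; move: uA uB.
  case: IA fA => // ra _; case: IB fB => // rb _.
  by rewrite -!EFinM => -[<-] [<-]; rewrite -mulrBr.
rewrite ler_pM2l// IK.
have ik := integrable_kern a0 d0 (@measurable_upper n.+1) Dfar.
have ick : (mu n.+2).-integrable (upper n.+1)
    (fun t => ((U x - m) * kern alpha (x - row_of t))%:E).
  exact: (integrableZl (@measurable_upper n.+1) (U x - m) ik).
have [] := @integrable_integralB _ _ _ (mu n.+2) (upper n.+1)
  (fun t => frac_quotient alpha U x (row_of t))
  (fun t => (U x - m) * kern alpha (x - row_of t))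
  (fun t => (m - U (row_of t)) * kern alpha (x - row_of t)) (@measurable_upper n.+1)
  iK ick.
  by move=> t; rewrite frac_quotientE -mulrBl; congr (_ * _); ring.
move=> imU ImU.
pose I1 : \bar R :=
  (\int[mu n.+2]_(t in upper n.+1) (kern alpha (x - row_of t))%:E)%E.
pose I2 : \bar R :=
  (\int[mu n.+2]_(t in upper n.+1) (frac_quotient alpha U x (row_of t))%:E)%E.
have f1 : I1 \is a fin_num by apply: integrable_fin_num ik; exact: measurable_upper.
have f2 : I2 \is a fin_num by apply: integrable_fin_num iK; exact: measurable_upper.
have b1 : (I1 <= (4 ^+ n.+2 / (1 - 2 `^ (- alpha)) * delta `^ (- alpha))%:E)%E.
  exact: integral_kern_le Dfar.
have b2 : (I2 - (U x - m)%:E * I1 <= (m * (kappa n.+2 alpha * rho `^ (- alpha)))%:E)%E.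
  have -> : ((U x - m)%:E * I1 = \int[mu n.+2]_(t in upper n.+1)
      ((U x - m) * kern alpha (x - row_of t))%:E)%E.
    exact: (esym (integralZl (@measurable_upper n.+1) ik _)).
  rewrite -[X in (X <= _)%E]ImU.
  apply: (antisymmetric_integral_le (lambda := lambda) (delta := delta)) => //.
  - move=> t tQ; rewrite /upper_half_space/= mxE.
    by move: (tQ ord_max); rewrite in_itv/= => /andP[h _]; exact: le_lt_trans xr h.
  - exact: reflection_diffN.
  - exact: measurable_reflection_diff.
rewrite -/I2; clearbody I1 I2; case: I1 f1 b1 b2 => // i1 _; case: I2 f2 => // i2 _.
rewrite -EFinM -EFinB !lee_fin /= => b1 b2.
have : (U x - m) * i1 <=
    (U x - m) * (4 ^+ n.+2 / (1 - 2 `^ (- alpha)) * delta `^ (- alpha)).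
  by rewrite ler_wpM2l// subr_ge0.
by move: (_ * i1) b2 (_ * (_ * delta `^ _)) => z b2 z' zz'; lra.
Qed.
End normal_comparison.

(** * Mean value and Hoelder estimates along lines *)

Section calculus_on_lines.
Context {R : realType}.

Lemma is_derive_line (V : normedModType R) (f : V -> R) (x v : V) (t : R) :
  differentiable f (x + t *: v) ->
  is_derive t (1 : R) (fun s => f (x + s *: v)) ('D_v f (x + t *: v)).
Proof.
move=> df.
have E : (fun h : R => h^-1 *: (((fun s => f (x + s *: v)) \o shift t) (h *: (1 : R)) -
    f (x + t *: v))) =
  (fun h : R => h^-1 *: ((f \o shift (x + t *: v)) (h *: v) - f (x + t *: v))).
  apply/funext => h; congr (_ *: (f _ - _)).
  by rewrite /= [_ *: 1]mulr1 scalerDl addrCA addrA.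
apply: DeriveDef.
  by rewrite /derivable E; exact: diff_derivable.
by rewrite /derive E.
Qed.

Lemma MVT_line (V : normedModType R) (f : V -> R) (x v : V) :
  (forall s : R, 0 <= s <= 1 -> differentiable f (x + s *: v)) ->
  exists2 c : R, 0 < c < 1 & f (x + v) - f x = 'D_v f (x + c *: v).
Proof.
move=> df; pose g (s : R) : R := f (x + s *: v).
pose dg (s : R) : R := 'D_v f (x + s *: v).
have g' (s : R) : s \in `[0, 1]%R -> is_derive s (1 : R) g (dg s).
  by rewrite in_itv/= => /df; exact: is_derive_line.
have g'' (s : R) : s \in `]0, 1[%R -> is_derive s (1 : R) g (dg s).
  by move=> s01; apply: g'; exact: subset_itv_oo_cc.
have cg : {within `[0, 1], continuous g}.
  by apply: derivable_within_continuous => s /g' [].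
have [c] := MVT (ltr01 : (0 : R) < 1) g'' cg.
rewrite in_itv/= => c01; rewrite /g /dg scale1r scale0r addr0 subr0 mulr1 => ?.
by exists c.
Qed.

Lemma derive_dirN (V W : normedModType R) (f : V -> W) (x v : V) :
  differentiable f x -> 'D_(- v) f x = - 'D_v f x.
Proof. by move=> df; rewrite !deriveE// raddfN. Qed.

Lemma C1_holder_reflection_min (n : nat) (theta lambda : R) (u : 'rV[R]_n.+2 -> R)
    (x : 'rV[R]_n.+2) : 0 < theta -> C1_holder_loc theta u -> x 0 ord0 <= lambda ->
  (forall y : 'rV[R]_n.+2, y 0 ord0 <= lambda ->
    reflection_diff lambda u x <= reflection_diff lambda u y) ->
  exists M, forall t, 0 < t < 1 ->
    reflection_diff lambda u (x - t *: delta_mx 0 ord_max) - reflection_diff lambda u x <=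
    M * t `^ (1 + theta).
Proof.
move=> th0 [du uH] xl Umin; pose e : 'rV[R]_n.+2 := delta_mx 0 ord_max.
pose U := reflection_diff lambda u; set x' := reflection lambda x.
have xe (t : R) : reflection lambda (x - t *: e) = x' - t *: e.
  apply/rowP => i; rewrite !mxE !eqxx /=; case: eqP => [->|] //.
  by rewrite /= !mulr0 !subr0.
have UE (t : R) : U (x - t *: e) = u (x' + t *: - e) - u (x + t *: - e).
  by rewrite /U /reflection_diff xe -scalerN.
pose dphi t : R := 'D_(- e) u (x' + t *: - e) - 'D_(- e) u (x + t *: - e).
have dU (t : R) : is_derive t (1 : R) (fun t => U (x - t *: e)) (dphi t).
  rewrite (_ : (fun t => _) = (fun s => u (x' + s *: - e)) - (fun s => u (x + s *: - e))).
    by apply: is_deriveB; apply: is_derive_line; exact: du.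
  by apply/funext => s; rewrite UE.
(* Moving along the last axis in either direction keeps the first coordinate, so 0 is an interior
   minimum of the restriction to the line. *)
have dphi0 : dphi 0 = 0.
  have [_ <-] := dU 0; apply: derive_val; apply: (@derive1_at_min R _ (-1) 1 0).
  - by lra.
  - by move=> t _; case: (dU t).
  - by rewrite in_itv/=; apply/andP; split; lra.
  - by move=> t _; rewrite scale0r subr0; apply: Umin; rewrite !mxE /= mulr0 subr0.
(* One Hoelder constant is needed for both segments, the one from [x] and the one from its
   reflection. *)
have [K [cK Kx Kx']] : exists K : set 'rV[R]_n.+2, [/\ compact K,
    forall t, 0 <= t <= 1 -> K (x + t *: - e) &
    forall t, 0 <= t <= 1 -> K (x' + t *: - e)].
  pose S (y : 'rV[R]_n.+2) : set 'rV[R]_n.+2 := [set y + s *: - e | s in `[0, 1]].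
  have cS y : compact (S y).
    apply: continuous_compact; last exact: segment_compact.
    apply: continuous_subspaceT => s; apply: cvgD; first exact: cvg_cst.
    exact: scalel_continuous.
  exists (S x `|` S x'); split; first by apply: compactU.
  - by move=> t t01; left; exists t => //=; rewrite in_itv.
  - by move=> t t01; right; exists t => //=; rewrite in_itv.
have [M MH] := uH ord_max K cK.
(* Each of the two points contributes one [M]; the absolute value is there because the Hoelder
   constant carries no sign. *)
exists (`|M| *+ 2) => t /andP[t0 t1].
pose phi (s : R) : R := U (x - s *: e).
have phi' (s : R) : s \in `]0, t[%R -> is_derive s (1 : R) phi (dphi s).
  by move=> _; exact: dU.
have cphi : {within `[0, t], continuous phi}.
  by apply: derivable_within_continuous => s _; case: (dU s).
have [c] := MVT t0 phi' cphi; rewrite in_itv/= => /andP[c0 ct].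
rewrite /phi scale0r !subr0 => ->.
have holder (y : 'rV[R]_n.+2) : K y -> K (y + c *: - e) ->
    `|'D_(- e) u (y + c *: - e) - 'D_(- e) u y| <= `|M| * t `^ theta.
  move=> Ky Kyc; rewrite !derive_dirN// opprK addrC.
  apply: le_trans (MH _ _ Ky Kyc) _.
  have -> : enorm (y - (y + c *: - e)) = c.
    rewrite opprD addrA subrr sub0r scalerN opprK /enorm (bigD1 ord_max)//= big1 ?addr0.
      by rewrite !mxE !eqxx mulr1 sqrtr_sqr gtr0_norm.
    by move=> i i0; rewrite !mxE (negbTE i0) andbF mulr0 expr0n.
  apply: (@le_trans _ _ (`|M| * c `^ theta)).
    by rewrite ler_wpM2r ?powR_ge0// ler_norm.
  rewrite ler_wpM2l// ge0_ler_powR ?nnegrE ?(ltW c0) ?(ltW t0) ?(ltW th0)//.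
  exact: ltW.
have c01 : 0 <= c <= 1 by rewrite (ltW c0) (ltW (lt_trans ct t1)).
have Kxx : K x by have := Kx 0; rewrite scale0r addr0; apply; rewrite lexx ler01.
have Kxx' : K x' by have := Kx' 0; rewrite scale0r addr0; apply; rewrite lexx ler01.
have h1 := holder _ Kxx (Kx _ c01); have h2 := holder _ Kxx' (Kx' _ c01).
rewrite powRD ?(gt_eqF t0) ?implybT// powRr1 ?(ltW t0)// mulrCA mulrC ler_pM2l//.
have : dphi c = dphi c - dphi 0 by rewrite dphi0 subr0.
move: h1 h2; rewrite !ler_norml => /andP[h1 _] /andP[_ h2].
have swap (k1 k2 k3 k4 : R) : (k1 - k2) - (k3 - k4) = (k1 - k3) - (k2 - k4) by ring.
rewrite {2 3}/dphi !scale0r !addr0 => ->; rewrite swap mulrnAl mulr2n.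
by rewrite -[X in _ <= _ + X]opprK; apply: lerB.
Qed.
End calculus_on_lines.

(** * Passage to the boundary for the nonlocal normal derivative *)

Section normal_limit.
Context {R : realType}.
Local Notation TR := (measurableTypeR R).

(* On the boundary of the half space neither equation holds; it is reached from
   below. *)
Lemma nonlocal_normal_limit_le n (alpha lambda rho theta : R)
    (u : 'rV[R]_n.+2 -> R) (x : 'rV[R]_n.+2) (a b : R -> R) (A B : R) :
  0 < alpha < 2 -> 0 < theta -> alpha - 1 < theta ->
  0 < rho -> x 0 ord0 <= lambda <= x 0 ord0 + rho ->
  x 0 ord_max <= 0 -> 0 < x 0 ord_max + rho ->
  measurable_fun [set: n.+2.-tuple TR] (u \o @row_of R n.+2) -> L_space alpha u ->
  C1_holder_loc theta u ->
  (forall y : 'rV[R]_n.+2, y 0 ord0 <= lambda ->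
    reflection_diff lambda u x <= reflection_diff lambda u y) ->
  reflection_diff lambda u x <= 0 ->
  (forall t, 0 < t ->
    nonlocal_normal alpha u (x - t *: delta_mx 0 ord_max) = (a t)%:E) ->
  (forall t, 0 < t ->
    nonlocal_normal alpha u (reflection lambda x - t *: delta_mx 0 ord_max) = (b t)%:E) ->
  a t @[t --> 0^'+] --> A -> b t @[t --> 0^'+] --> B ->
  B - A <= frac_const n.+2 alpha * (kappa n.+2 alpha * rho `^ (- alpha)) *
    reflection_diff lambda u x.
Proof.
move=> a02 th0 ath r0 /andP[xl lx] xn xr mU uL uC Umin U0 ua ub ca cb.
have [M hM] := C1_holder_reflection_min th0 uC xl Umin.
pose e : 'rV[R]_n.+2 := delta_mx 0 ord_max.
set U := reflection_diff lambda u in Umin U0 hM *.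
set C := frac_const n.+2 alpha; have C0 : 0 < C by exact: frac_const_gt0.
set k := kappa _ _ * _.
pose K1 : R := 4 ^+ n.+2 / (1 - 2 `^ (- alpha)).
have K10 : 0 <= K1.
  have /andP[a0 _] := a02.
  rewrite divr_ge0 ?exprn_ge0// subr_ge0 powRN invf_le1 ?powR_gt0//.
  have := @ge0_ler_powR R alpha (ltW a0) 1 2; rewrite powR1 !nnegrE.
  by apply; rewrite ?ler1n.
have e0 : 0 < 1 + theta - alpha by lra.
(* The error is the deviation [t]^ (1 + theta)[from the minimum times the kernel mass]t
   [^ (- alpha)]; it vanishes because [alpha - 1 < theta]. *)
have lim : (b t - a t) - (C * M * K1) * t `^ (1 + theta - alpha) @[t --> 0^'+] -->
    (B - A) - (C * M * K1) * 0.
  by apply: cvgB; [exact: cvgB|apply: cvgMr; exact: powR_cvg0].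
rewrite mulr0 subr0 in lim; apply: (cvgr_to_le lim); near=> t.
have t0 : 0 < t by near: t; exact: nbhs_right_gt.
have t1 : t < 1 by near: t; exact: nbhs_right_lt.
have tr : t < x 0 ord_max + rho by near: t; exact: nbhs_right_lt.
have xe0 : (x - t *: e) 0 ord0 = x 0 ord0 by rewrite !mxE /= mulr0 subr0.
have xen : (x - t *: e) 0 ord_max = x 0 ord_max - t by rewrite !mxE !eqxx /= mulr1.
have rxe : reflection lambda (x - t *: e) = reflection lambda x - t *: e.
  apply/rowP => i; rewrite !mxE !eqxx /=; case: eqP => [->|] //.
  by rewrite /= !mulr0 !subr0.
(* The lower bound [m] stays the minimum [U x], while the equation is used at depth [t] below
   [x]. *)
have := @nonlocal_normal_reflection_le R n alpha lambda rho t (U x) u (x - t *: e)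
  (a t) (b t) a02 r0 t0.
rewrite rxe xe0 xen xl lx => /(_ isT).
have -> : x 0 ord_max - t <= - t by lra.
have -> : 0 <= x 0 ord_max - t + rho by lra.
move=> /(_ isT isT mU uL U0 (Umin _ _) Umin (ua _ t0) (ub _ t0)).
rewrite xe0 => /(_ xl) h; rewrite lerBlDr; apply: le_trans h _.
rewrite -/U -/C -/k -/K1 mulrDr [leRHS]addrC.
apply: lerD; last by rewrite [U x * _]mulrC mulrA.
have -> : C * M * K1 * t `^ (1 + theta - alpha) =
    C * ((M * t `^ (1 + theta)) * (K1 * t `^ (- alpha))).
  rewrite [1 + theta - alpha]/(_ + - alpha) powRD ?(gt_eqF t0) ?implybT//; ring.
rewrite ler_pM2l//; apply: (ler_wpM2r (mulr_ge0 K10 (powR_ge0 _ _))).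
by apply: hM; rewrite t0.
Unshelve. all: by end_near.
Qed.
End normal_limit.

(** * Increments of the nonlinearities *)

Section increments.
Context {R : realType}.
Implicit Types (f h : R * R -> R).

Lemma near_right_prod (P : R -> R -> Prop) :
  (\forall y \near 0^'+ & z \near 0^'+, P y z) ->
  exists2 eta, 0 < eta & forall y z, 0 < y < eta -> 0 < z < eta -> P y z.
Proof.
have right_ball (S : set R) : (0^'+ : set_system R) S ->
    exists2 e, 0 < e & forall y, 0 < y < e -> S y.
  move=> /nbhs_ballP[e /= e0 eS]; exists e => // y /andP[y0 ye].
  by apply: eS => //; rewrite /ball/= sub0r normrN gtr0_norm.
move=> [[S T] /= [/right_ball[e1 e10 e1S] /right_ball[e2 e20 e2T]] ST].
exists (Num.min e1 e2); first by rewrite lt_min e10.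
move=> y z; rewrite !lt_min => /and3P[y0 y1 _] /and3P[z0 _ z2].
by apply: (ST (y, z)); split; [apply: e1S|apply: e2T]; apply/andP.
Qed.

(** The quadrant is convex, so the segment stays where [f] is differentiable; linearity of the
    differential splits the directional derivative. *)
Lemma MVT_quadrant f (z w : R * R) :
  (forall z, open_quadrant z -> differentiable f z) ->
  open_quadrant z -> open_quadrant (z + w) ->
  exists c : R, [/\ 0 < c < 1, open_quadrant (z + c *: w) &
    f (z + w) - f z = w.1 * partial1 f (z + c *: w) + w.2 * partial2 f (z + c *: w)].
Proof.
move=> df [z1 z2] [w1 w2].
have Q (s : R) : 0 <= s <= 1 -> open_quadrant (z + s *: w).
  have convex (a b : R) : 0 <= s <= 1 -> 0 < a -> 0 < a + b -> 0 < a + s * b.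
    move=> /andP[s0 s1] a0 ab0; have -> : a + s * b = (1 - s) * a + s * (a + b) by ring.
    have [s'|s'] := ltP s 1; last first.
      by rewrite ltr_wpDl ?mulr_gt0 ?mulr_ge0 ?subr_ge0 ?(ltW a0)//; lra.
    by rewrite ltr_pwDl ?mulr_gt0 ?subr_gt0// mulr_ge0// ltW.
  by move=> s01; split; apply: convex.
have [c c01 E] := @MVT_line R _ f z w (fun s s01 => df _ (Q s s01)).
have c01' : 0 <= c <= 1 by case/andP: c01 => c0 c1; rewrite !ltW.
exists c; split=> //; first exact: Q.
have dfc := df _ (Q _ c01').
rewrite {}E /partial1 /partial2 !deriveE//.
have wE : w = w.1 *: ((1, 0) : R * R) + w.2 *: ((0, 1) : R * R).
  by case: (w) => w1' w2'; congr pair; rewrite /= ?scaler0 ?addr0 ?add0r [_ *: _]mulr1.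
have linearE (g : {linear (R * R)%type -> R}) : g w = w.1 * g (1, 0) + w.2 * g (0, 1).
  by rewrite {1}wE linearD !linearZ.
exact: linearE.
Qed.

(* The value [v'] may be large (the reflected point may be near the origin), so
   the second argument is moved at the first argument [u'], where only the sign
   of [partial2 f] is used when [v <= v']. *)
Lemma coupled_increment_ge f (eta p q mu u v u' v' : R) :
  (forall z, open_quadrant z -> differentiable f z) ->
  (forall z, open_quadrant z -> 0 < partial2 f z) ->
  (forall y z, 0 < y < eta -> 0 < z < eta ->
    partial1 f (y, z) <= y `^ (p - 1) * z `^ q) ->
  (forall y z, 0 < y < eta -> 0 < z < eta ->
    partial2 f (y, z) <= y `^ p * z `^ (q - 1)) ->
  1 <= p -> 1 <= q -> 0 < mu -> 0 < u' -> u' < u -> u < eta ->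
  0 < v -> v < eta -> 0 < v' ->
  mu * (u' - u) <= v' - v ->
  (u `^ (p - 1) * v `^ q + mu * (u `^ p * v `^ (q - 1))) * (u' - u) <=
    f (u', v') - f (u, v).
Proof.
move=> df fv0 fu fv p1 q1 mu0 u'0 u'u ueta v0 veta v'0 uv.
have u0 := lt_trans u'0 u'u.
have le_powR (r x y : R) : 0 <= r -> 0 < x -> x <= y -> x `^ r <= y `^ r.
  by move=> r0 x0 xy; rewrite ge0_ler_powR ?nnegrE ?(ltW x0)// ltW// (lt_le_trans x0).
have q0 : 0 <= q by lra.
have p0 : 0 <= p by lra.
have qm : 0 <= q - 1 by lra.
have pm : 0 <= p - 1 by lra.
have first : mu * (u `^ p * v `^ (q - 1)) * (u' - u) <= f (u', v') - f (u', v).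
  have [||c [/andP[c0 c1] Qc]] := @MVT_quadrant f (u', v) (0, v' - v) df.
  - by split.
  - by split; rewrite /= ?addr0// addrC subrK.
  have -> : (u', v) + (0, v' - v) = (u', v').
    by congr pair; rewrite /= ?addr0// addrC subrK.
  move=> ->; rewrite mul0r add0r.
  have zE : (u', v) + c *: (0, v' - v) = (u', v + c * (v' - v)).
    by congr pair; rewrite /= scaler0 addr0.
  rewrite zE in Qc *; have := fv0 _ Qc; have := fv u' (v + c * (v' - v)).
  case: Qc => /= _; set z := v + _ => z0.
  set d := partial2 f _ => fvle d0.
  have k0 : 0 <= u `^ p * v `^ (q - 1) by rewrite mulr_ge0 ?powR_ge0.
  (* If [v <= v'], the left side is nonpositive and the increment nonnegative. *)
  have [vv|vv] := leP 0 (v' - v).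
    apply: (@le_trans _ _ 0); last by rewrite mulr_ge0// ltW.
    by rewrite mulr_ge0_le0 ?subr_le0 ?(ltW u'u)// mulr_ge0// ltW.
  (* Here [v' < v], so the intermediate point stays below [eta] and the growth bound on [partial2 f]
     applies. *)
  have zv : z <= v by rewrite /z gerDl mulr_ge0_le0 ?ltW.
  have dk : d <= u `^ p * v `^ (q - 1).
    apply: le_trans (fvle _ _) _; first by rewrite u'0 (lt_trans u'u).
      by rewrite z0 (le_lt_trans zv).
    by rewrite ler_pM ?powR_ge0 ?le_powR ?(ltW u'u).
  rewrite mulrAC; apply: (@le_trans _ _ ((v' - v) * (u `^ p * v `^ (q - 1)))).
    by rewrite ler_wpM2r.
  by rewrite ler_wnM2l// ltW.
have second : u `^ (p - 1) * v `^ q * (u' - u) <= f (u', v) - f (u, v).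
  have [||c [/andP[c0 c1] Qc]] := @MVT_quadrant f (u, v) (u' - u, 0) df.
  - by split.
  - by split; rewrite /= ?addr0// addrC subrK.
  have -> : (u, v) + (u' - u, 0) = (u', v).
    by congr pair; rewrite /= ?addr0// addrC subrK.
  move=> ->; rewrite mul0r addr0.
  have zE : (u, v) + c *: (u' - u, 0) = (u + c * (u' - u), v).
    by congr pair; rewrite /= scaler0 addr0.
  rewrite zE in Qc *; have := fu (u + c * (u' - u)) v.
  case: Qc => /= + _; set z := u + _ => z0 fule.
  have zu : z <= u by rewrite /z gerDl mulr_ge0_le0 ?ltW// subr_lt0.
  rewrite mulrC ler_wnM2l ?subr_le0 ?(ltW u'u)//.
  apply: le_trans (fule _ _) _; first by rewrite z0 (le_lt_trans zu).
    by rewrite v0.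
  by rewrite ler_wpM2r ?powR_ge0// le_powR.
have -> : f (u', v') - f (u, v) =
  (f (u', v) - f (u, v)) + (f (u', v') - f (u', v)) by ring.
by rewrite mulrDl lerD.
Qed.

(** As [u' - u <= 0], replacing [partial1 h] by its upper bound [- mu * partial2 h] bounds the
    increment below by [v' - v - mu * (u' - u)] times [partial2 h], a product of nonnegative
    factors. *)
Lemma dominated_increment_ge0 h (mu u v u' v' : R) :
  (forall z, open_quadrant z -> differentiable h z) ->
  (forall z, open_quadrant z -> 0 < partial2 h z) ->
  (forall z, open_quadrant z -> mu * partial2 h z <= - partial1 h z) ->
  0 < u -> 0 < v -> 0 < u' -> 0 < v' -> u' <= u -> mu * (u' - u) <= v' - v ->
  h (u, v) <= h (u', v').
Proof.
move=> dh hv0 hdom u0 v0 u'0 v'0 uu uv; rewrite -subr_ge0.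
have [||c [_ Qc]] := @MVT_quadrant h (u, v) (u' - u, v' - v) dh.
- by split.
- by split; rewrite /= addrC subrK.
have -> : (u, v) + (u' - u, v' - v) = (u', v') by congr pair; rewrite /= addrC subrK.
move=> ->; move: (hv0 _ Qc) (hdom _ Qc) => /=.
move: (partial1 _ _) (partial2 _ _) => d1 d2 d20 d12.
apply: (@le_trans _ _ ((v' - v - mu * (u' - u)) * d2)).
  by rewrite mulr_ge0 ?subr_ge0// ltW.
have : (u' - u) * - (mu * d2) <= (u' - u) * d1.
  by rewrite ler_wnM2l ?subr_le0// lerNr.
by clear; lra.
Qed.
End increments.

(** * Decay at infinity for one of the two unknowns *)

Section decay.
Context {R : realType}.
Local Notation TR := (measurableTypeR R).

Lemma inv_powR_lt (a eta r : R) : 0 < a -> 0 < eta -> eta^-1 `^ a^-1 < r ->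
  1 / r `^ a < eta.
Proof.
move=> a0 eta0 er; have r0 : 0 < r by apply: le_lt_trans er; exact: powR_ge0.
have := @gt0_ltr_powR R a a0 (eta^-1 `^ a^-1) r; rewrite !nnegrE powR_ge0 (ltW r0).
move=> /(_ isT isT er); rewrite -powRrM mulVf ?gt_eqF// powRr1 ?invr_ge0 ?(ltW eta0)//.
by rewrite div1r => h; rewrite -[ltRHS]invrK ltf_pV2 ?posrE ?invr_gt0 ?powR_gt0.
Qed.

Lemma not_closure_upper n (y : 'rV[R]_n.+1) : y 0 ord_max < 0 ->
  ~ closure (@upper_half_space R n) y.
Proof.
move=> y0 cl; have : nbhs y [set z | `|y 0 ord_max - z 0 ord_max| < - y 0 ord_max].
  have := @coord_continuous R 1 n.+1 0 ord_max y.
  move=> /cvgrPdist_lt/(_ (- y 0 ord_max)); apply; lra.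
move=> /cl[z [/= zp]]; rewrite ltr_norml => /andP[].
by move: zp; rewrite /upper_half_space/=; lra.
Qed.

Lemma le_powR_mul_decay (a b p q N u v : R) : 0 < N -> 0 <= p -> 0 <= q ->
  0 <= u <= 1 / N `^ a -> 0 <= v <= 1 / N `^ b ->
  u `^ p * v `^ q <= N `^ (- (a * p + b * q)).
Proof.
move=> N0 p0 q0 /andP[u0 ua] /andP[v0 vb].
rewrite opprD powRD ?(gt_eqF N0) ?implybT// -!mulNr !powRrM !powRN.
by apply: ler_pM; rewrite ?powR_ge0// ge0_ler_powR ?nnegrE// ?invr_ge0 ?powR_ge0// -div1r.
Qed.

(** The reflection preserves [enorm] distances; passing from sup-norm balls to [enorm] costs the
    square root of the dimension, and the added 1 makes the inequality strict. *)
Lemma reflection_continuous n (lambda : R) : continuous (@reflection R n lambda).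
Proof.
move=> y P /enorm_lt_nbhs[e e0 eP].
have s0 : 0 < Num.sqrt n.+1%:R + 1 :> R by rewrite ltr_wpDl ?sqrtr_ge0.
have d0 : 0 < e / (Num.sqrt n.+1%:R + 1) by exact: divr_gt0.
apply/nbhs_ballP; exists (e / (Num.sqrt n.+1%:R + 1)) => // z [_ yz].
apply: eP; rewrite enorm_reflectionB.
apply: (@le_lt_trans _ _ (Num.sqrt n.+1%:R * (e / (Num.sqrt n.+1%:R + 1)))).
  by apply: ler_enorm => [|i]; [exact: ltW|rewrite !mxE; exact: ltW (yz 0 i)].
by rewrite mulrA ltr_pdivrMr// mulrC ltr_pM2l// ltrDl.
Qed.

Lemma reflection_diff_continuous n (lambda : R) (u : 'rV[R]_n.+1 -> R)
    (y : 'rV[R]_n.+1) :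
  continuous u -> {for y, continuous (reflection_diff lambda u)}.
Proof.
move=> cu; apply: (@continuousB _ _ _ (u \o @reflection R n lambda) u); last exact: cu.
by apply: continuous_comp; [exact: reflection_continuous|exact: cu].
Qed.

(** Only the equations of [u] enter, which lets the other claim follow by exchanging the unknowns.
    The proof is by contradiction, from [mu * U x <= V x]. *)
Lemma decay_at_infinity n (alpha theta : R) (f h : R * R -> R)
    (u v : 'rV[R]_n.+2 -> R) (a b p q mu : R) :
  0 < alpha < 2 -> 0 < theta -> alpha - 1 < theta ->
  (forall z, open_quadrant z -> differentiable f z) ->
  (forall z, open_quadrant z -> differentiable h z) ->
  L_space alpha u -> C1_holder_loc theta u -> continuous v ->
  (forall x, 0 < u x) -> (forall x, 0 < v x) ->
  (forall x, upper_half_space x -> is_frac_laplacian alpha u x (f (u x, v x))) ->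
  (forall x, ~ closure (@upper_half_space R n.+1) x ->
    nonlocal_normal alpha u x = (h (u x, v x))%:E) ->
  0 < a -> 0 < b -> 1 <= p -> 1 <= q ->
  (exists M, forall x, M < enorm x -> u x <= 1 / enorm x `^ a) ->
  (exists M, forall x, M < enorm x -> v x <= 1 / enorm x `^ b) ->
  (\forall y \near 0^'+ & z \near 0^'+, partial1 f (y, z) <= y `^ (p - 1) * z `^ q) ->
  (\forall y \near 0^'+ & z \near 0^'+, partial2 f (y, z) <= y `^ p * z `^ (q - 1)) ->
  (forall w, open_quadrant w -> 0 < partial2 f w) ->
  (forall w, open_quadrant w -> 0 < partial2 h w) ->
  0 < mu ->
  (forall w, open_quadrant w -> mu * partial2 h w <= - partial1 h w) ->
  alpha < a * p + b * q - a -> alpha < a * p + b * q - b ->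
  exists2 R0, 0 < R0 & forall lambda, lambda < 0 -> forall x : 'rV[R]_n.+2,
    left_half_space lambda x -> R0 < enorm x ->
    (forall z, closure (@left_half_space R n.+1 lambda) z ->
      reflection_diff lambda u x <= reflection_diff lambda u z) ->
    reflection_diff lambda u x < 0 ->
    reflection_diff lambda v x < mu * reflection_diff lambda u x.
Proof.
move=> a02 th0 ath df dh uL uC cv u0 v0 ueq ubd a0 b0 p1 q1 [Ma hMa] [Mb hMb].
move=> /near_right_prod[e1 e10 fu] /near_right_prod[e2 e20 fv] fv0 hv0 mu0 hdom al1 al2.
pose eta := Num.min e1 e2; have eta0 : 0 < eta by rewrite lt_min e10.
pose k : R := frac_const n.+2 alpha * kappa n.+2 alpha * 2 `^ (- alpha).
have k0 : 0 < k.
  by apply: mulr_gt0; [apply: mulr_gt0; [exact: frac_const_gt0|exact: kappa_gt0]|exact: powR_gt0].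
(* [d] is the surplus of decay over the order of the operator. *)
pose d := Num.min (a * p + b * q - a) (a * p + b * q - b) - alpha.
have d0 : 0 < d by rewrite subr_gt0 lt_min al1.
pose R0 := Num.max 1 (Num.max (Num.max Ma Mb)
  (Num.max (Num.max (eta^-1 `^ a^-1) (eta^-1 `^ b^-1)) (((1 + mu) / k) `^ d^-1))).
exists R0; first by rewrite lt_max ltr01.
move=> lambda lam0 x xl; rewrite !gt_max => /and3P[N1 /andP[NMa NMb] /andP[/andP[Ne1 Ne2] Nd]].
move=> Umin U0; rewrite ltNge; apply/negP => VU.
have cu : continuous u by move=> y; apply: differentiable_continuous; exact: uC.1.
have mU := L_space_measurable u0 uL.
have {}Umin (y : 'rV[R]_n.+2) : y 0 ord0 <= lambda ->
    reflection_diff lambda u x <= reflection_diff lambda u y.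
  by move=> yl; apply: Umin; exact: closure_left_half_space.
set N := enorm x in N1 NMa NMb Ne1 Ne2 Nd; have N0 : 0 < N by exact: lt_trans N1.
have xN i : - N <= x 0 i.
  by have := ler_enorm_coord x i; rewrite ler_norml => /andP[].
(* Coordinates of [x] are at least [- N], so adding [2 * N] makes them positive: as [lambda < 0],
   this passes the hyperplane, and it also enters the upper half space. *)
pose rho := 2 * N; have r0 : 0 < rho by rewrite mulr_gt0.
have xlr : x 0 ord0 <= lambda <= x 0 ord0 + rho.
  move: xl (xN ord0); rewrite /left_half_space/= /rho => xl xN0; apply/andP; split; lra.
have xnr : 0 < x 0 ord_max + rho by move: (xN ord_max); rewrite /rho; lra.
have uu : u (reflection lambda x) < u x by rewrite -subr_lt0.
have kE : frac_const n.+2 alpha * (kappa n.+2 alpha * rho `^ (- alpha)) = k * N `^ (- alpha).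
  by rewrite powRM// ?(ltW N0)// /k !mulrA.
(* The case [x 0 ord_max <= 0] comes first; it includes the boundary, so the exterior equation is
   used at points just below. *)
have [xn|xn] := ltP 0 (x 0 ord_max); last first.
  have cut (w : 'rV[R]_n.+2 -> R) (y : 'rV[R]_n.+2) : continuous w ->
      w (y - t *: delta_mx 0 ord_max) @[t --> 0^'+] --> w y.
    move=> cw; apply: (@cvg_at_right_filter _ _ (fun t => w (y - t *: delta_mx 0 ord_max))).
    have ct : {for 0, continuous (fun t : R => y - t *: delta_mx 0 ord_max)}.
      apply: (@continuousB _ _ _ (cst y) (fun t : R => t *: delta_mx 0 ord_max)).
        exact: cst_continuous.
      exact: scalel_continuous.
    have : w (y - t *: delta_mx 0 ord_max) @[t --> (0 : R)] -->
        w (y - 0 *: delta_mx 0 ord_max) by exact: (continuous_comp ct (cw _)).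
    by rewrite scale0r subr0.
  have ch (y : 'rV[R]_n.+2) : h (u (y - t *: delta_mx 0 ord_max),
      v (y - t *: delta_mx 0 ord_max)) @[t --> 0^'+] --> h (u y, v y).
    have chy : {for (u y, v y), continuous h}.
      by apply/differentiable_continuous/dh; split; [exact: u0|exact: v0].
    exact: (cvg_comp _ _ (cvg_pair (cut u y cu) (cut v y cv)) chy).
  have := @nonlocal_normal_limit_le R n alpha lambda rho theta u x
    (fun t => h (u (x - t *: delta_mx 0 ord_max), v (x - t *: delta_mx 0 ord_max)))
    (fun t => h (u (reflection lambda x - t *: delta_mx 0 ord_max),
      v (reflection lambda x - t *: delta_mx 0 ord_max)))
    (h (u x, v x)) (h (u (reflection lambda x), v (reflection lambda x)))
    a02 th0 ath r0 xlr xn xnr mU uL uC Umin (ltW U0).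
  move=> /(_ _ _ (ch _) (ch _)) h1.
  have : h (u (reflection lambda x), v (reflection lambda x)) - h (u x, v x) < 0.
    apply: le_lt_trans (h1 _ _) _.
    - by move=> t t0; apply: ubd; apply: not_closure_upper; rewrite !mxE !eqxx/= mulr1; lra.
    - by move=> t t0; apply: ubd; apply: not_closure_upper; rewrite !mxE !eqxx/= mulr1; lra.
    - by rewrite kE pmulr_rlt0// mulr_gt0// powR_gt0.
  (* The comparison makes [h] strictly smaller at the reflected point, against its monotonicity
     along the increment. *)
  rewrite subr_lt0 ltNge => /negP; apply.
  exact: (dominated_increment_ge0 dh hv0 hdom) (ltW uu) VU.
have := @frac_laplacian_reflection_le R n alpha lambda rho u x _ _ a02 r0 xlr mU uL
  _ Umin U0 (ueq x xn) (ueq (reflection lambda x) _).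
have xln : upper_half_space (reflection lambda x) by rewrite /upper_half_space/= !mxE/=.
move=> /(_ (@reflection_diff_continuous n.+1 lambda u (reflection lambda x) cu) xln); rewrite kE => h1.
have ua : u x <= 1 / N `^ a by exact: hMa.
have vb : v x <= 1 / N `^ b by exact: hMb.
have ue : u x < eta by exact: le_lt_trans ua (inv_powR_lt a0 eta0 Ne1).
have ve : v x < eta by exact: le_lt_trans vb (inv_powR_lt b0 eta0 Ne2).
have fu' y z : 0 < y < eta -> 0 < z < eta -> partial1 f (y, z) <= y `^ (p - 1) * z `^ q.
  by rewrite !lt_min => /and3P[? ? _] /and3P[? ? _]; apply: fu; apply/andP.
have fv' y z : 0 < y < eta -> 0 < z < eta -> partial2 f (y, z) <= y `^ p * z `^ (q - 1).
  by rewrite !lt_min => /and3P[? _ ?] /and3P[? _ ?]; apply: fv; apply/andP.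
have h2 := coupled_increment_ge df fv0 fu' fv' p1 q1 mu0 (u0 _) uu ue (v0 x) ve (v0 _) VU.
(* Both bounds carry the factor [U x]; cancelling this negative number reverses the inequality. *)
have {h1 h2} : k * N `^ (- alpha) <=
    u x `^ (p - 1) * v x `^ q + mu * (u x `^ p * v x `^ (q - 1)).
  by rewrite -(ler_nM2r U0); exact: le_trans h2 h1.
have NdE : N `^ (- alpha) * N `^ (- d) = N `^ (- (alpha + d)).
  by rewrite [- (alpha + d)]opprD powRD ?(gt_eqF N0) ?implybT.
have pw (e : R) : alpha + d <= e -> N `^ (- e) <= N `^ (- alpha) * N `^ (- d).
  by move=> de; rewrite NdE; apply: (ler_powR (ltW N1)); rewrite lerN2.
have [de1 de2] : alpha + d <= a * p + b * q - a /\ alpha + d <= a * p + b * q - b.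
  by rewrite /d addrC subrK; split; rewrite ge_min lexx ?orbT.
have ux : 0 <= u x <= 1 / N `^ a by rewrite ltW.
have vx : 0 <= v x <= 1 / N `^ b by rewrite ltW.
have p0 : 0 <= p by lra.
have q0 : 0 <= q by lra.
have pm : 0 <= p - 1 by lra.
have qm : 0 <= q - 1 by lra.
have B1 : u x `^ (p - 1) * v x `^ q <= N `^ (- alpha) * N `^ (- d).
  apply: le_trans (le_powR_mul_decay N0 pm q0 ux vx) (pw _ _).
  by apply: le_trans de1 _; rewrite le_eqVlt; apply/orP; left; apply/eqP; ring.
have B2 : u x `^ p * v x `^ (q - 1) <= N `^ (- alpha) * N `^ (- d).
  apply: le_trans (le_powR_mul_decay N0 p0 qm ux vx) (pw _ _).
  by apply: le_trans de2 _; rewrite le_eqVlt; apply/orP; left; apply/eqP; ring.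
move=> kB; have {kB} : k * N `^ (- alpha) <= (1 + mu) * (N `^ (- alpha) * N `^ (- d)).
  by apply: le_trans kB _; rewrite mulrDl mul1r lerD// ler_wpM2l// ltW.
(* Cancelling [N]^ (- alpha)[leaves]N [^ d <= (1 + mu) / k], which the choice of [R0] forbids. *)
rewrite mulrCA mulrC ler_pM2l ?powR_gt0// powRN ler_pdivlMr ?powR_gt0//.
rewrite mulrC -ler_pdivlMr//; apply/negP; rewrite -ltNge.
have c0 : 0 <= (1 + mu) / k by rewrite divr_ge0 ?(ltW k0)// addr_ge0 ?(ltW mu0).
have := @gt0_ltr_powR R d d0 (((1 + mu) / k) `^ d^-1) N; rewrite !nnegrE powR_ge0 (ltW N0).
by move=> /(_ isT isT Nd); rewrite -powRrM mulVf ?(gt_eqF d0)// powRr1.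
Qed.
End decay.

(** * Exchange of the two unknowns *)

Section swap.
Context {R : realType}.
Implicit Types (f : R * R -> R) (z : R * R).

Definition swap_args f z : R := f (z.2, z.1).

Lemma swap_open_quadrant z : open_quadrant z -> @open_quadrant R (z.2, z.1).
Proof. by case=> z1 z2; split. Qed.

(** Holds by computation: the swap turns an increment along [(1, 0)] into one along [(0, 1)]. *)
Lemma partial1_swap_args f z : partial1 (swap_args f) z = partial2 f (z.2, z.1).
Proof. by []. Qed.

Lemma partial2_swap_args f z : partial2 (swap_args f) z = partial1 f (z.2, z.1).
Proof. by []. Qed.

Lemma differentiable_swap_args f :
  (forall z, open_quadrant z -> differentiable f z) ->
  forall z, open_quadrant z -> differentiable (swap_args f) z.
Proof.
move=> df z zQ.
apply: (@differentiable_comp _ _ _ _ (fun z : R * R => (z.2, z.1)) f z).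
  apply: differentiable_pair; apply: linear_differentiable => y.
    exact: cvg_snd.
  exact: cvg_fst.
exact/df/swap_open_quadrant.
Qed.

Lemma near_right_swap (P : R -> R -> Prop) :
  (\forall y \near 0^'+ & z \near 0^'+, P y z) ->
  \forall y \near 0^'+ & z \near 0^'+, P z y.
Proof.
move=> [[S T] /= [nS nT] ST]; exists (T, S) => //= -[y z] /= [Ty Sz].
exact: (ST (z, y)).
Qed.
End swap.

Theorem lemma3 (R : realType) (n : nat) (hn : (2 <= n.+1)%N)
  (alpha : R) (halpha : 0 < alpha < 2)
  (f g h l : R * R -> R)
  (hf : C1_quadrant f) (hg : C1_quadrant g)
  (hh : C1_quadrant h) (hl : C1_quadrant l)
  (theta : R) (htheta : Num.max 0 (alpha - 1) < theta)
  (u v : 'rV[R]_n.+1 -> R)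
  (uL : L_space alpha u) (vL : L_space alpha v)
  (uC : C1_holder_loc theta u) (vC : C1_holder_loc theta v)
  (u_gt0 : forall x, 0 < u x) (v_gt0 : forall x, 0 < v x)
  (u_eq : forall x, upper_half_space x ->
    is_frac_laplacian alpha u x (f (u x, v x)))
  (v_eq : forall x, upper_half_space x ->
    is_frac_laplacian alpha v x (g (u x, v x)))
  (u_bd : forall x, ~ closure (@upper_half_space R n) x ->
    nonlocal_normal alpha u x = (h (u x, v x))%:E)
  (v_bd : forall x, ~ closure (@upper_half_space R n) x ->
    nonlocal_normal alpha v x = (l (u x, v x))%:E)
  (a b p q r s : R) (ha : 0 < a) (hb : 0 < b)
  (hp : 1 <= p) (hq : 1 <= q) (hr : 1 <= r) (hs : 1 <= s)
  (u_decay : exists M : R, forall x, M < enorm x -> u x <= 1 / enorm x `^ a)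
  (v_decay : exists M : R, forall x, M < enorm x -> v x <= 1 / enorm x `^ b)
  (fu_le : \forall y \near 0^'+ & z \near 0^'+,
    partial1 f (y, z) <= y `^ (p - 1) * z `^ q)
  (gv_le : \forall y \near 0^'+ & z \near 0^'+,
    partial2 g (y, z) <= y `^ r * z `^ (s - 1))
  (fv_le : \forall y \near 0^'+ & z \near 0^'+,
    partial2 f (y, z) <= y `^ p * z `^ (q - 1))
  (gu_le : \forall y \near 0^'+ & z \near 0^'+,
    partial1 g (y, z) <= y `^ (r - 1) * z `^ s)
  (fv_gt0 : forall w, open_quadrant w -> 0 < partial2 f w)
  (gu_gt0 : forall w, open_quadrant w -> 0 < partial1 g w)
  (hu_lt0 : forall w, open_quadrant w -> partial1 h w < 0)
  (lv_lt0 : forall w, open_quadrant w -> partial2 l w < 0)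
  (hv_gt0 : forall w, open_quadrant w -> 0 < partial2 h w)
  (lu_gt0 : forall w, open_quadrant w -> 0 < partial1 l w)
  (mu nu : R) (hmu : 0 < mu) (hnu : 0 < nu) (hmunu : 1 < mu * nu)
  (h_dom : forall w, open_quadrant w -> mu * partial2 h w <= - partial1 h w)
  (l_dom : forall w, open_quadrant w -> nu * partial1 l w <= - partial2 l w)
  (alpha_lt : alpha < Num.min
    (Num.min (a * p + b * q - a) (a * p + b * q - b))
    (Num.min (a * r + b * s - a) (a * r + b * s - b))) :
  exists R0 : R, 0 < R0 /\ forall lambda : R, lambda < 0 ->
    let H := @left_half_space R n lambda in
    let U := reflection_diff lambda u in
    let V := reflection_diff lambda v in
    (forall x, H x -> R0 < enorm x ->
       (forall z, closure H z -> U x <= U z) -> U x < 0 ->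
       V x < mu * U x /\ mu * U x < 0) /\
    (forall y, H y -> R0 < enorm y ->
       (forall z, closure H z -> V y <= V z) -> V y < 0 ->
       U y < nu * V y /\ nu * V y < 0).
Proof.
(* Dimension at least 2 becomes the shape [n.+2], for which [ord0] and [ord_max] are visibly
   distinct. *)
case: n hn u v uL vL uC vC u_gt0 v_gt0 u_eq v_eq u_bd v_bd u_decay v_decay => [//|n] _.
move=> u v uL vL uC vC u0 v0 u_eq v_eq u_bd v_bd u_decay v_decay.
move: htheta; rewrite gt_max => /andP[th0 ath].
move: alpha_lt; rewrite !lt_min => /andP[/andP[al1 al2] /andP[al3 al4]].
have cts (w : 'rV[R]_n.+2 -> R) : C1_holder_loc theta w -> continuous w.
  by move=> wC y; apply: differentiable_continuous; exact: wC.1.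
have [R1 R10 HU] := decay_at_infinity halpha th0 ath hf.2.1 hh.2.1 uL uC (cts _ vC) u0 v0
  u_eq u_bd ha hb hp hq u_decay v_decay fu_le fv_le fv_gt0 hv_gt0 hmu h_dom al1 al2.
(* With [v] as first unknown, [a] and [b] trade places, and the exponents [p] and [q] become [s] and
   [r]. *)
have [||||||||R2 R20 HV] := @decay_at_infinity R n alpha theta (swap_args g) (swap_args l)
  v u b a s r nu halpha th0 ath (differentiable_swap_args hg.2.1)
  (differentiable_swap_args hl.2.1) vL vC (cts _ uC) v0 u0 v_eq v_bd hb ha hs hr
  v_decay u_decay.
- apply: near_right_swap; apply: filterS gv_le => -[y z].
  by rewrite partial1_swap_args /= mulrC.
- apply: near_right_swap; apply: filterS gu_le => -[y z].
  by rewrite partial2_swap_args /= mulrC.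
- by move=> w /swap_open_quadrant; exact: gu_gt0.
- by move=> w /swap_open_quadrant; exact: lu_gt0.
- exact: hnu.
- by move=> w /swap_open_quadrant; exact: l_dom.
- by rewrite (addrC (b * s)).
- by rewrite (addrC (b * s)).
exists (Num.max R1 R2); split; first by rewrite lt_max R10.
move=> lambda lam0 H U V; split.
- move=> x xH; rewrite gt_max => /andP[xR _] Umin U0; split; last by rewrite pmulr_rlt0.
  exact: (HU lambda lam0 x xH xR Umin U0).
- move=> x xH; rewrite gt_max => /andP[_ xR] Vmin V0; split; last by rewrite pmulr_rlt0.
  exact: (HV lambda lam0 x xH xR Vmin V0).
Qed.
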